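(* Let $V$ be a set of $n$ vertices and let $e_1,\ldots,e_{n-1}$ be a sequence of edges on $V$ that form a tree, arriving one at a time. To perform these $n-1$ edge insertions, the total time required by the Rank-Based Dancing-Walk Algorithm (defined in the context) is at most $O(n)$ with high probability in $n$.
   Context: Conventions. Logarithms are base 2; quantities such as $c\log\log n$, $d\log n$ are treated as integers. Running time is in the usual unit-cost RAM model. $c$ and $d$ are sufficiently large constants (parameters of the algorithm). ''With high probability in $n$'' means with probability at least $1-1/n^a$, where the constant $a>0$ can be made as large as desired by choosing the constants sufficiently large. The edge sequence is fixed independently of the algorithm's random bits. Problem (incremental edge orientation in a forest). After each arrival the algorithm must maintain an orientation of all edges inserted so far; these always form a forest on $V$. Flipping an edge means reversing its direction. Combination rank. A tree of size $1$ has combination rank $R(T)=0$. When trees $T_1,T_2$ of the current (undirected) forest are combined by an edge insertion into $T_3$, set $R(T_3)=\max(R(T_1),R(T_2))$ if $R(T_1)\ne R(T_2)$, and $R(T_3)=R(T_1)+1$ if $R(T_1)=R(T_2)$. The Rank-Based Dancing-Walk Algorithm. Each vertex has at most two primary out-going edges and at most one secondary out-going edge. When $e_t=\{v_1,v_2\}$ arrives, let $T_1\ni v_1$, $T_2\ni v_2$ be the two trees of the current forest joined by $e_t$, with names chosen so that $R(T_1)\le R(T_2)$ (ties broken arbitrarily, independently of the random bits). The combination ranks are maintained by a data structure of leaf-to-root pointer trees in which comparing ranks and merging takes $O(1+\min(R(T_1),R(T_2)))$ time. The algorithm performs a random walk starting at $v_1$ along primary directed edges. If the walk is at a vertex of out-degree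 less than $2$ (possibly $v_1$ itself), it terminates successfully there. Otherwise it moves along a uniformly random one of the two primary out-going edges of the current vertex. If it has not terminated earlier, it stops after $c\log\log n$ moves at a vertex $u$; if $u$ has out-degree less than $3$ the walk succeeds (when $u$ has out-degree exactly $2$, $u$ is said to volunteer, taking on a secondary out-going edge), while if $u$ has out-degree $3$ the walk fails. Failed walks are restarted from scratch with fresh randomness, up to $d\log n$ attempts in total; if all fail, the algorithm declares failure and stops. After a successful walk ending at $u$, all edges of the walk from $v_1$ to $u$ are flipped, and $e_t$ is oriented out of $v_1$. An edge newly out-going from a vertex $w$ is primary, replacing a lost primary edge or filling a free primary place, except that the new out-going edge of a volunteering vertex is its secondary edge. *)

(* Defs.v *)
From HB Require Import structures.
From mathcomp Require Import all_boot all_order all_algebra.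
From mathcomp Require Import reals exp.
Set Implicit Arguments.
Unset Strict Implicit.
Unset Printing Implicit Defensive.
Import Order.TTheory GRing.Theory Num.Theory.

Local Open Scope nat_scope.

(* An edge {x, y} is stored as (x, y) or as (y, x).  The order in which it is
   stored is used only to break ties between equal ranks (see [name_ends]). *)
Definition adj (V : eqType) (es : seq (V * V)) : rel V :=
  fun x y => ((x, y) \in es) || ((y, x) \in es).

Definition forms_tree (V : finType) (es : seq (V * V)) : Prop :=
  [/\ size es = #|V|.-1,
      all (fun e => e.1 != e.2) es,
      pairwise (fun e f => (f != e) && (f != (e.2, e.1))) es,
      forall x y : V, connect (adj es) x y
    & forall p : seq V, ucycle (adj es) p -> size p <= 2].

Definition combine_rank (r1 r2 : nat) : nat :=
  if r1 == r2 then r1.+1 else maxn r1 r2.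

(* [crank past v] is the combination rank of the tree that contains v in the
   forest with edge list [past], which lists the latest insertion first. *)
Fixpoint crank (V : finType) (past : seq (V * V)) (v : V) : nat :=
  if past is e :: past' then
    if connect (adj past') v e.1 || connect (adj past') v e.2
    then combine_rank (crank past' e.1) (crank past' e.2)
    else crank past' v
  else 0.

(* The pair (v1, v2) with R(T1) <= R(T2).  Ranks do not depend on the random
   bits, so letting the stored order of the edge decide ties, and quantifying
   over all sequences of pairs, covers every tie-breaking rule that is
   independent of the random bits. *)
Definition name_ends (V : finType) (past : seq (V * V)) (e : V * V) : V * V :=
  if crank past e.1 <= crank past e.2 then e else (e.2, e.1).

(* An orientation, given by the heads of the out-going edges of each vertex. *)
Record orientation (V : Type) := Orientation {
  primary : V -> seq V;
  secondary : V -> option V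
}.

Definition no_edges (V : Type) : orientation V :=
  Orientation (fun _ => [::]) (fun _ => None).

Definition outdeg (V : Type) (o : orientation V) (w : V) : nat :=
  size (primary o w) + isSome (secondary o w).

(* The vertices visited after w.  One bit is used per move, so the length of
   [bits] is the maximal number of moves.  A vertex acquires a secondary edge
   only when it has two primary ones, and never loses either afterwards, so
   out-degree at least 2 means that there are two primary edges and the default
   value of [nth] is not used. *)
Fixpoint walk (V : Type) (o : orientation V) (w : V) (bits : seq bool)
    : seq V :=
  if outdeg o w < 2 then [::] else
  if bits is b :: bits' then
    let w' := nth w (primary o w) b in w' :: walk o w' bits'
  else [::].

Definition walk_succeeds (V : Type) (o : orientation V) (v1 : V) (p : seq V) :=
  outdeg o (last v1 p) < 3.

Definition replace_primary (V : eqType) (o : orientation V) (w old new : V) :=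
  Orientation
    [eta primary o with
       w |-> [seq if y == old then new else y | y <- primary o w]]
    (secondary o).

(* A new out-going edge for the last vertex of a successful walk: if its
   out-degree is already 2, it volunteers. *)
Definition gain_edge (V : eqType) (o : orientation V) (u x : V) :=
  if outdeg o u < 2 then
    Orientation [eta primary o with u |-> rcons (primary o u) x] (secondary o)
  else Orientation (primary o) [eta secondary o with u |-> Some x].

(* [flip_walk o v2 v1 p] flips the edges of the walk v1 :: p and orients the
   inserted edge from v1 to v2.  In the recursion, x is the head of the edge
   that becomes out-going from w. *)
Fixpoint flip_walk (V : eqType) (o : orientation V) (x w : V) (p : seq V) :=
  if p is w' :: p' then flip_walk (replace_primary o w w' x) w w' p'
  else gain_edge o w x.

(* Numbers of unit-cost operations: [rank_cost * (1 + min (R(T1), R(T2)))] for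
   the arrival of an edge, the comparison of the ranks and the merge in the
   data structure for the ranks; [try_cost] for starting an attempt and testing
   its success; [move_cost] for a move of a walk, including the random choice;
   [flip_cost] for orienting the new edge or flipping an edge. *)
Record costs := Costs {
  rank_cost : nat;
  try_cost : nat;
  move_cost : nat;
  flip_cost : nat
}.

(* [attempts] lists the random bits of the successive attempts.  The result is
   the time spent and the new orientation, or [None] if all attempts fail. *)
Fixpoint try_walks (V : eqType) (L : nat) (k : costs) (o : orientation V)
    (v1 v2 : V) (attempts : seq (L.-tuple bool))
    : nat * option (orientation V) :=
  if attempts is bits :: attempts' then
    let p := walk o v1 bits in
    let t := try_cost k + move_cost k * size p in
    if walk_succeeds o v1 p then
      (t + flip_cost k * (size p).+1, Some (flip_walk o v2 v1 p))
    else
      let: (t', res) := try_walks k o v1 v2 attempts' in (t + t', res)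
  else (0, None).

Fixpoint run_from (V : finType) (M L : nat) (k : costs) (past : seq (V * V))
    (o : orientation V) (es : seq (V * V))
    (omega : seq (M.-tuple (L.-tuple bool)))
    : nat * option (orientation V) :=
  match es, omega with
  | e :: es', attempts :: omega' =>
    let: (v1, v2) := name_ends past e in
    let t_rank := rank_cost k * (1 + minn (crank past v1) (crank past v2)) in
    let: (t_walk, res) := try_walks k o v1 v2 attempts in
    if res is Some o' then
      let: (t', final) := run_from k (e :: past) o' es' omega' in
      (t_rank + t_walk + t', final)
    else (t_rank + t_walk, None)
  | _, _ => (0, Some o)
  end.

(* The random bits: for each of m insertions, up to M attempts of up to L moves
   each.  Every move that is made reads its own bit. *)
Definition randomness (m M L : nat) : finType :=
  m.-tuple (M.-tuple (L.-tuple bool)).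

(* Total time, and final orientation unless failure was declared. *)
Definition dancing_walk (V : finType) (m M L : nat) (k : costs)
    (es : seq (V * V)) (omega : randomness m M L)
    : nat * option (orientation V) :=
  run_from k [::] (no_edges V) es omega.

Local Open Scope ring_scope.

Definition log2 (R : realType) (x : R) : R := ln x / ln 2.

Definition walk_length (R : realType) (c : R) (n : nat) : nat :=
  `|Num.ceil (c * log2 (log2 n%:R))|%N.

Definition max_attempts (R : realType) (d : R) (n : nat) : nat :=
  `|Num.ceil (d * log2 n%:R)|%N.

(* Probability under the uniform distribution on a finite type. *)
Definition Pr (R : realType) (T : finType) (E : pred T) : R :=
  #|[set x | E x]|%:R / #|T|%:R.

(* All insertions of [es] are performed, in total time at most B. *)
Definition performs_within (R : realType) (V : finType) (m M L : nat)
    (k : costs) (es : seq (V * V)) (B : R) (omega : randomness m M L) : bool :=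
  let: (t, final) := dancing_walk k es omega in
  isSome final && (t%:R <= B).

(* Main.v *)
(* Let r be the combination rank, always at most K = log n.

   Cost of the walks.  Let y = 1 + O(1 / L), where L is the walk length.  For
   every vertex x, the mean of y ^ (number of moves of a walk from x) stays at
   most y ^ (3 r(x)): this is preserved by each insertion, because the rank of
   every vertex of the smaller-rank tree grows.  The sum of 1 + min (R(T1),
   R(T2)) over all insertions is at most 2n, so the exponential moment of the
   total cost is y ^ O(n), and Markov's inequality bounds the probability of a
   cost above C n by y ^ (- 2n) = exp (- Omega (n / L)).

   Failures.  An attempt fails with probability at most 1/8 unless an eighth of
   the 2 ^ L end points of full walks have volunteered.  As a vertex is in the
   smaller-rank tree at most K times, and its new out-neighbour is then
   determined by the edge sequence alone, there are at most
   (2 (K + 1) ^ 2) ^ (2 ^ L) candidates for the set of volunteers among these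
   end points.  A fixed set of s vertices volunteers entirely with probability
   at most (K M / 2 ^ L) ^ s, where M is the number of attempts, because the
   product of the volunteering bounds [phi] of its vertices is a
   supermartingale.  For 2 ^ L >= K ^ 40 a union bound applies. *)

Require Import Defs.
From HB Require Import structures.
From mathcomp Require Import all_boot all_order all_algebra.
From mathcomp Require Import reals exp.
From mathcomp Require Import zify ring lra.
Set Implicit Arguments.
Unset Strict Implicit.
Unset Printing Implicit Defensive.
Import Order.TTheory GRing.Theory Num.Theory.
Local Open Scope ring_scope.

(** * Forests and combination ranks *)

Local Open Scope nat_scope.

(** Cycles of two vertices are tolerated because a symmetric relation has one for every edge. *)
Definition acyclic (V : finType) (g : rel V) : Prop :=
  forall p : seq V, ucycle g p -> size p <= 2.

Definition avoid (V : eqType) (g : rel V) (x : V) : rel V :=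
  fun a b => [&& g a b, a != x & b != x].

(** * Directed paths in a forest *)

Section Forest.
Variables (V : finType) (g : rel V).
Hypotheses (gsym : symmetric g) (girr : irreflexive g) (gacyc : acyclic g).

Lemma path_avoid x y p : path g y p -> x \notin y :: p -> path (avoid g x) y p.
Proof.
elim: p y => //= z p IH y /andP[gyz pz].
rewrite !inE !negb_or => /and3P[xy xz xp].
by rewrite {1}/avoid gyz eq_sym xy eq_sym xz IH // inE negb_or xz.
Qed.

(** Otherwise a path from y to y' that misses x would close, through x, a cycle of at least three
    vertices. *)
Lemma neighbor_avoid_inj x y y' :
  g x y -> g x y' -> connect (avoid g x) y y' -> y = y'.
Proof.
move=> gxy gxy' /connectP[p0 pp0 yl]; move: gxy'; rewrite {}yl.
case/shortenP: pp0 => p pp up _ gxl.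
have yx : y != x by apply: contraTneq gxy => ->; rewrite girr.
have xp : x \notin y :: p.
  rewrite inE negb_or eq_sym yx /=.
  elim: p y pp {up gxl gxy yx} => //= z p IH y /andP[/and3P[_ _ zx] pz].
  by rewrite inE negb_or eq_sym zx (IH z).
have gp : path g y p by apply: sub_path pp => a b /and3P[].
have : ucycle g (x :: y :: p).
  by rewrite /ucycle /= rcons_path gxy gp gsym gxl /= xp.
by move/gacyc; case: p {pp up gxl xp gp}.
Qed.

Variable d : rel V.
Hypotheses (dg : subrel d g) (danti : forall x y, d x y -> ~~ d y x).

(** A first return to x closes a cycle of [g]. As this has at most two vertices, it is an edge of
    [d] taken in both directions, against [danti]. *)
Lemma dpath_uniq x p : path d x p -> uniq (x :: p).
Proof.
elim: p x => //= y p IH x /andP[dxy py].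
have /= /andP[yp up] := IH _ py.
rewrite yp up !andbT inE negb_or.
have -> /= : x != y by apply: contraTneq (dg dxy) => ->; rewrite girr.
apply/negP => xp; case/splitPr: xp py yp up => p1 p2.
rewrite cat_path /= mem_cat inE !negb_or cat_uniq /=.
case/and3P=> py1 dlx _ /and3P[yp1 yx _] /and3P[up1 /norP[xp1 _] _].
have : ucycle g (x :: y :: p1).
  rewrite /ucycle /= rcons_path (dg dxy) (sub_path dg py1) (dg dlx) /=.
  by rewrite inE negb_or eq_sym yx xp1 yp1.
move/gacyc; case: p1 dlx {py1 yp1 up1 xp1} => //= dyx.
by move: (danti dxy); rewrite dyx.
Qed.

Lemma digraph_acyclic x c : d x c -> ~~ connect d c x.
Proof.
move=> dxc; apply/negP => /connectP[p pp xl].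
have /dpath_uniq /= : path d x (c :: p) by rewrite /= dxc.
by rewrite {1}xl mem_last.
Qed.

Lemma connect_avoid x c z : d x c -> connect d c z -> connect (avoid g x) c z.
Proof.
move=> dxc /connectP[p pp ->]; apply/connectP; exists p => //.
have /dpath_uniq /= /andP[xp _] : path d x (c :: p) by rewrite /= dxc.
by apply: path_avoid => //; apply: sub_path pp.
Qed.

Lemma avoid_sym x : symmetric (avoid g x).
Proof. by move=> a b; rewrite /avoid gsym; congr andb; rewrite andbC. Qed.

(** Directed paths from a child of x never return to x, so a common end point z joins the two
    children in the forest without x. *)
Lemma child_unique x c1 c2 z :
  d x c1 -> d x c2 -> connect d c1 z -> connect d c2 z -> c1 = c2.
Proof.
move=> d1 d2 z1 z2; apply: (neighbor_avoid_inj (dg d1) (dg d2)).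
apply: connect_trans (connect_avoid d1 z1) _.
by rewrite (sym_connect_sym (@avoid_sym x)); apply: connect_avoid.
Qed.

End Forest.

(** * Combination ranks and component sizes *)

Section Adj.
Variable V : finType.
Implicit Types (past es : seq (V * V)) (x y v : V) (e : V * V).

Lemma adj_sym past : symmetric (adj past).
Proof. by move=> x y; rewrite /adj orbC. Qed.

Lemma conn_sym past : symmetric (connect (adj past)).
Proof. by apply: sym_connect_sym; apply: adj_sym. Qed.

Lemma adj_cons e past x y :
  adj (e :: past) x y =
  [|| (x, y) == e, (y, x) == e | adj past x y].
Proof. by rewrite /adj !inE; do !case: (_ == _); rewrite ?orbT. Qed.

Lemma conn_cons e past x y :
  connect (adj past) x y -> connect (adj (e :: past)) x y.
Proof.
by apply: connect_sub => a b ab; apply: connect1; rewrite adj_cons ab !orbT.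
Qed.

Lemma conn_ends e past : connect (adj (e :: past)) e.1 e.2.
Proof. by apply: connect1; rewrite adj_cons -surjective_pairing eqxx. Qed.

Lemma conn_left past x y z :
  connect (adj past) x y -> connect (adj past) x z = connect (adj past) y z.
Proof. by move=> c; apply: (same_connect (@conn_sym past) c). Qed.

Lemma crank_conn past x y :
  connect (adj past) x y -> crank past x = crank past y.
Proof.
elim: past x y => //= e past IH x y /connectP[p pp ->{y}].
elim: p x pp => //= z p IHp x /andP[xz /IHp <-] {IHp}.
have cxz : connect (adj past) x z ->
  [|| connect (adj past) x e.1 | connect (adj past) x e.2] =
  [|| connect (adj past) z e.1 | connect (adj past) z e.2].
  by move=> c; rewrite !(conn_left _ c).
move: xz; rewrite adj_cons => /or3P[/eqP <-|/eqP <-|xz] /=.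
- by rewrite !connect0 orbT.
- by rewrite !connect0 orbT.
by have c := connect1 xz; rewrite (cxz c) (IH x z c).
Qed.

Lemma combine_rankC r1 r2 : combine_rank r1 r2 = combine_rank r2 r1.
Proof.
by rewrite /combine_rank eq_sym maxnC; case: eqP => // ->.
Qed.

Lemma combine_rank_max r1 r2 : maxn r1 r2 <= combine_rank r1 r2.
Proof.
by rewrite /combine_rank; case: eqP => // ->; rewrite maxnn.
Qed.

Lemma combine_rank_lt r1 r2 : r1 <= r2 -> r1 < combine_rank r1 r2.
Proof.
rewrite /combine_rank leq_eqVlt; case: eqP => [->|_ /= lt] //.
by rewrite leq_max lt orbT.
Qed.

Lemma crank_mono e past x : crank past x <= crank (e :: past) x.
Proof.
rewrite /=; case: ifP => // /orP[]/crank_conn ->.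
  by apply: leq_trans (combine_rank_max _ _); rewrite leq_maxl.
by apply: leq_trans (combine_rank_max _ _); rewrite leq_maxr.
Qed.

Lemma name_endsP past e v1 v2 : name_ends past e = (v1, v2) ->
  crank past v1 <= crank past v2 /\ (e = (v1, v2) \/ e = (v2, v1)).
Proof.
case: e => a b; rewrite /name_ends /=; case: leqP => [le|/ltnW le] [<- <-].
  by split=> //; left.
by split=> //; right.
Qed.

Lemma crank_named e past v1 v2 x : name_ends past e = (v1, v2) ->
  connect (adj past) x v1 \/ connect (adj past) x v2 ->
  crank (e :: past) x = combine_rank (crank past v1) (crank past v2).
Proof.
move=> /name_endsP[_ [->|->]] /= /orP c; first by rewrite c.
by rewrite orbC c combine_rankC.
Qed.

(** This strict growth is behind every count below: each insertion with x in the smaller-rank tree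
    is charged to an increase of the rank of x. *)
Lemma crank_touched e past v1 v2 x : name_ends past e = (v1, v2) ->
  connect (adj past) x v1 -> crank past x < crank (e :: past) x.
Proof.
move=> ne c; rewrite (crank_named ne (or_introl c)) (crank_conn c).
by apply: combine_rank_lt; case: (name_endsP ne).
Qed.

Definition comp past x : {set V} := [set y | connect (adj past) x y].

(** The new rank exceeds both old ones only if these are equal, and then two disjoint components of
    at least 2 ^ r vertices each are united. *)
Lemma crank_card e past x :
  (forall z, 2 ^ crank past z <= #|comp past z|) ->
  ~~ connect (adj past) e.1 e.2 ->
  2 ^ crank (e :: past) x <= #|comp (e :: past) x|.
Proof.
move=> IH nc /=; case: ifP => [c|_]; last first.
  apply: leq_trans (IH x) _; apply: subset_leq_card; apply/subsetP => y.
  by rewrite !inE; apply: conn_cons.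
have cU : comp past e.1 :|: comp past e.2 \subset comp (e :: past) x.
  have c1 : connect (adj (e :: past)) x e.1.
    case/orP: c => /(conn_cons e) // c; apply: connect_trans c _.
    by rewrite conn_sym conn_ends.
  apply/subsetP => y; rewrite !inE => /orP[] /(conn_cons e) c2.
    exact: connect_trans c1 c2.
  exact: connect_trans (connect_trans c1 (conn_ends e past)) c2.
have dj : [disjoint comp past e.1 & comp past e.2].
  apply/pred0Pn => -[y]; rewrite /= !inE => /andP[c1 c2].
  case/negP: nc; apply: connect_trans c1 _; by rewrite conn_sym.
apply: leq_trans (subset_leq_card cU); rewrite cardsU.
have -> : comp past e.1 :&: comp past e.2 = set0.
  by apply/eqP; rewrite setI_eq0.
rewrite cards0 subn0 /combine_rank.
have h1 := IH e.1; have h2 := IH e.2.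
case: eqP => [eq|_]; first by rewrite expnS mul2n -addnn leq_add // eq.
rewrite /maxn; case: ifP => _.
  exact: leq_trans h2 (leq_addl _ _).
exact: leq_trans h1 (leq_addr _ _).
Qed.

(* [past] lists the latest insertion first, so that [catrev past es] is the
   whole edge sequence. *)
Record forest_from past es : Prop := ForestFrom {
  forest_loop : all (fun e => e.1 != e.2) (catrev past es);
  forest_simple :
    pairwise (fun e f => (f != e) && (f != (e.2, e.1))) (catrev past es);
  forest_acyclic : acyclic (adj (catrev past es));
  forest_rank : forall x, 2 ^ crank past x <= #|comp past x|
}.

Lemma adj_irr es : all (fun e => e.1 != e.2) es -> irreflexive (adj es).
Proof.
move=> /allP ne x; rewrite /adj orbb; apply/negP => /ne /=.
by rewrite eqxx.
Qed.

Lemma sub_adj_catrev past es : subrel (adj past) (adj (catrev past es)).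
Proof.
by move=> x y; rewrite /adj catrevE !mem_cat !mem_rev => /orP[] ->; rewrite ?orbT.
Qed.

Lemma sub_acyclic (g g' : rel V) : subrel g g' -> acyclic g' -> acyclic g.
Proof.
move=> sg ac p /andP[cp up]; apply: ac; apply/andP; split => //.
by apply: sub_cycle cp => a b; apply: sg.
Qed.

Lemma past_irr past es : forest_from past es -> irreflexive (adj past).
Proof.
case=> /adj_irr irr _ _ _ x; apply/negP => /(@sub_adj_catrev past es).
by rewrite irr.
Qed.

Lemma past_acyclic past es : forest_from past es -> acyclic (adj past).
Proof. by case=> _ _ ac _; apply: sub_acyclic ac; apply: sub_adj_catrev. Qed.

(** An older path between the ends would close a cycle with e. If this cycle has only two vertices,
    e repeats an earlier edge, up to its stored order. *)
Lemma forest_new past e es :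
  forest_from past (e :: es) -> ~~ connect (adj past) e.1 e.2.
Proof.
case=> /allP ne pw ac _; apply/negP => /connectP[p0 pp0 el].
have eE : e \in catrev past (e :: es) by rewrite catrevE mem_cat inE eqxx orbT.
have := ne _ eE; rewrite {1}el.
have sadj := @sub_adj_catrev past (e :: es).
move: el; case/shortenP: pp0 => p pp up _ el le.
have : ucycle (adj (catrev past (e :: es))) (e.1 :: p).
  rewrite /ucycle /= rcons_path -el (sub_path sadj pp) /=.
  by rewrite /adj -surjective_pairing eE orbT.
move/ac; case: p pp up el le => [|y [|? ?]] //=; first by rewrite eqxx.
rewrite andbT => e1y _ ey _ _; move: pw; rewrite catrevE pairwise_cat => /and3P[/allrelP pw _ _].
have ne1 f : f \in past -> (e != f) && (e != (f.2, f.1)).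
  by move=> fp; apply: pw; rewrite ?mem_rev ?inE ?eqxx.
move: e1y; rewrite -ey /adj -surjective_pairing => /orP[]/ne1; rewrite ?eqxx //.
by rewrite /= -surjective_pairing eqxx andbF.
Qed.

Lemma forest_step past e es :
  forest_from past (e :: es) -> forest_from (e :: past) es.
Proof.
move=> F; have nc := forest_new F; case: F => ne pw ac rk; split => // x.
exact: crank_card.
Qed.

Lemma forest_start es : forms_tree es -> forest_from [::] es.
Proof.
case=> _ ne pw _ ac; split => // x; rewrite expn0 card_gt0.
by apply/set0Pn; exists x; rewrite inE.
Qed.

Lemma forest_crank past es x :
  forest_from past es -> crank past x <= trunc_log 2 #|V|.
Proof.
by case=> _ _ _ /(_ x) /leq_trans H; apply: trunc_log_max => //; apply/H/max_card.
Qed.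

End Adj.

(** The first named end lies in the tree of smaller rank, so each term is 1 + min (R(T1), R(T2)). *)
Fixpoint rank_sum (V : finType) (past es : seq (V * V)) : nat :=
  if es is e :: es' then
    (crank past (name_ends past e).1).+1 + rank_sum (e :: past) es'
  else 0.

Section RankSum.
Variable V : finType.
Implicit Types (past es : seq (V * V)) (e : V * V) (S : seq V).

(* Amortization: a tree of rank r holds r + 2 credits; [S] has one
   representative per tree. *)
Lemma rank_sum_credits past es S : forest_from past es -> uniq S ->
  (forall x, exists2 s, s \in S & connect (adj past) x s) ->
  {in S &, forall x y, connect (adj past) x y -> x = y} ->
  rank_sum past es <= \sum_(s <- S) (crank past s + 2).
Proof.
elim: es past S => //= e es IH past S F uS cov sep.
case ne : (name_ends past e) => [v1 v2] /=.
have [le ee] := name_endsP ne.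
have nc12 : ~~ connect (adj past) v1 v2.
  by have := forest_new F; case: ee => -> //=; rewrite conn_sym.
have [s1 S1 c1] := cov v1; have [s2 S2 c2] := cov v2.
have s12 : s2 != s1.
  apply: contraNneq nc12 => s12; rewrite s12 in c2.
  by rewrite (conn_left _ c1) conn_sym.
have S2' : s2 \in rem s1 S by rewrite mem_rem_uniq // inE s12.
have uS' : uniq (rem s1 S) by rewrite rem_uniq.
have v12 : connect (adj (e :: past)) v1 v2.
  by have := conn_ends e past; case: ee => -> //=; rewrite conn_sym.
have far x : x \in S -> x != s1 -> x != s2 ->
    ~~ (connect (adj past) x e.1 || connect (adj past) x e.2).
  move=> xS x1 x2; rewrite negb_or.
  have n1 : ~~ connect (adj past) x v1.
    apply: contraNN x1 => c; apply/eqP/sep => //; exact: connect_trans c c1.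
  have n2 : ~~ connect (adj past) x v2.
    apply: contraNN x2 => c; apply/eqP/sep => //; exact: connect_trans c c2.
  by case: ee => -> /=; rewrite n1 n2.
have new x y : connect (adj (e :: past)) x y ->
    ~~ (connect (adj past) x e.1 || connect (adj past) x e.2) ->
    connect (adj past) x y.
  move=> /connectP[p pp ->] {y}; elim: p x pp => //= z p IHp x /andP[xz pz] nx.
  have xz' : adj past x z.
    move: xz nx; rewrite adj_cons => /or3P[/eqP <-|/eqP <-|//] /=;
    by rewrite !connect0 ?orbT.
  have c := connect1 xz'; apply: (connect_trans c); apply: IHp => //.
  by rewrite -!(conn_left _ c).
have h1 x : exists2 s, s \in rem s1 S & connect (adj (e :: past)) x s.
  have [s sS cs] := cov x.
  have [ss1|ss1] := eqVneq s s1.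
    exists s2 => //; rewrite ss1 in cs.
    apply: (@connect_trans _ _ v1).
      apply: conn_cons; by rewrite conn_sym (conn_left _ c1) conn_sym.
    by apply: connect_trans v12 _; apply: conn_cons.
  by exists s; [rewrite mem_rem_uniq // inE ss1|apply: conn_cons].
have h2 : {in rem s1 S &, forall x y, connect (adj (e :: past)) x y -> x = y}.
  move=> x y; rewrite ![_ \in rem s1 S]mem_rem_uniq // !inE => /andP[x1 xS] /andP[y1 yS] cxy.
  have [xs2|x2] := eqVneq x s2.
    have [ys2|y2] := eqVneq y s2; first by rewrite xs2 ys2.
    apply: sep => //; rewrite conn_sym; apply: new (far _ yS y1 y2).
    by rewrite conn_sym.
  by apply: sep => //; apply: new cxy (far _ xS x1 x2).
have := IH (e :: past) (rem s1 S) (forest_step F) uS' h1 h2.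
rewrite [X in _ -> _ <= X](big_rem s1) //= [X in _ -> _ <= _ + X](big_rem s2) //=.
rewrite (big_rem s2) //=.
have -> : \sum_(y <- rem s2 (rem s1 S))
     ((if connect (adj past) y e.1 || connect (adj past) y e.2
       then combine_rank (crank past e.1) (crank past e.2)
       else crank past y) + 2) = \sum_(y <- rem s2 (rem s1 S)) (crank past y + 2).
  apply: eq_big_seq => y; rewrite mem_rem_uniq // inE mem_rem_uniq // inE => /and3P[y2 y1 yS].
  by rewrite (negPf (far _ yS y1 y2)).
have -> : (if connect (adj past) s2 e.1 || connect (adj past) s2 e.2
       then combine_rank (crank past e.1) (crank past e.2)
       else crank past s2) = combine_rank (crank past v1) (crank past v2).
  by apply: (crank_named ne); right; rewrite conn_sym.
rewrite -(crank_conn c1) -(crank_conn c2) => H.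
(* Of the [crank past v1 + 2] credits of the tree of v1, all but one pay for the insertion; the last
   one covers a possible increase of the other rank. *)
have cr : combine_rank (crank past v1) (crank past v2) <= (crank past v2).+1.
  rewrite /combine_rank; case: eqP => [-> //|_].
  by rewrite (maxn_idPr le).
apply: leq_trans (leq_add (leqnn _) H) _.
rewrite !addnA leq_add2r; move: cr; lia.
Qed.

Lemma rank_sum_linear es : forest_from [::] es -> rank_sum [::] es <= 2 * #|V|.
Proof.
move=> F; apply: leq_trans (@rank_sum_credits _ _ (enum V) F (enum_uniq _) _ _) _.
- by move=> x; exists x; rewrite ?mem_enum.
- move=> x y _ _ /connectP[[|z p]] //= /andP[]; by rewrite /adj.
by rewrite big_const_seq count_predT iter_addn_0 /= -cardE.
Qed.

End RankSum.

(** The head of the edge that x gains if a walk from v1 passes through it: the neighbour of x on the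
    forest path to v1, unique by [neighbor_avoid_inj], or v2 at v1 itself. *)
Definition next_hop (V : finType) (past : seq (V * V)) (v1 v2 x : V) : seq V :=
  if x == v1 then [:: v2] else
  if [pick y | adj past x y && connect (avoid (adj past) x) y v1] is Some y
  then [:: y] else [::].

(* All vertices that an out-going edge of x can have pointed to, whatever the
   random bits: a walk from v1 through x, in a forest, gives x an edge towards
   v1. *)
Fixpoint cand (V : finType) (past : seq (V * V)) (x : V) : seq V :=
  if past is e :: past' then
    (if connect (adj past') x (name_ends past' e).1 then
       next_hop past' (name_ends past' e).1 (name_ends past' e).2 x
     else [::]) ++ cand past' x
  else [::].

Section Candidates.
Variable V : finType.
Implicit Types (past es : seq (V * V)) (e : V * V) (x y : V).

Lemma cand_adj past x y : y \in cand past x -> adj past x y.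
Proof.
elim: past => //= e past IH; rewrite mem_cat adj_cons => /orP[|/IH ->]; last first.
  by rewrite !orbT.
case ne : (name_ends past e) => [v1 v2] /=.
have [_ ee] := name_endsP ne.
case: ifP => // _; rewrite /next_hop; case: eqP => [->|_].
  by rewrite inE => /eqP ->; case: ee => ->; rewrite !eqxx ?orbT.
by case: pickP => // z /andP[xz _]; rewrite inE => /eqP ->; rewrite xz !orbT.
Qed.

(** An insertion adds at most one candidate, and only when it also raises the rank of x. *)
Lemma size_cand past x : size (cand past x) <= crank past x.
Proof.
elim: past x => //= e past IH x; rewrite size_cat.
case ne : (name_ends past e) => [v1 v2] /=; rewrite -/(crank (e :: past) x).
case: ifP => c; last by apply: leq_trans (IH x) (crank_mono e past x).
have s1 : size (next_hop past v1 v2 x) <= 1.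
  by rewrite /next_hop; case: eqP => // _; case: pickP.
by apply: leq_trans (leq_add s1 (IH x)) _; apply: crank_touched ne c.
Qed.

End Candidates.

(** * Invariants of the orientation *)

Section Orientation.
Variable V : finType.
Implicit Types (past es : seq (V * V)) (e : V * V) (o : orientation V) (x y z : V).

(** Secondary edges are left out because walks never follow them. *)
Definition edge o : rel V := fun x y => y \in primary o x.

Record oriented past o : Prop := Oriented {
  primary_cand : forall x, {subset primary o x <= cand past x};
  primary_uniq : forall x, uniq (primary o x);
  primary_size : forall x, size (primary o x) <= 2;
  secondary_full : forall x, isSome (secondary o x) -> size (primary o x) = 2;
  edge_anti : forall x y, edge o x y -> ~~ edge o y x
}.

Lemma edge_adj past o : oriented past o -> subrel (edge o) (adj past).
Proof. by move=> O x y /(primary_cand O) /cand_adj. Qed.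

Lemma reach_conn past o x y : oriented past o ->
  connect (edge o) x y -> connect (adj past) x y.
Proof.
by move=> O; apply: connect_sub => a b /(edge_adj O); apply: connect1.
Qed.

Lemma full_primary past o x : oriented past o -> 1 < outdeg o x ->
  size (primary o x) = 2.
Proof.
move=> O; rewrite /outdeg; have := secondary_full O (x := x).
case: (secondary o x) => [?|] /= H; first by rewrite H.
rewrite addn0 => s; apply/eqP; rewrite eqn_leq s andbT; exact: primary_size O x.
Qed.

Lemma flip_walk_off o x w p z : z \notin w :: p ->
  primary (flip_walk o x w p) z = primary o z /\
  secondary (flip_walk o x w p) z = secondary o z.
Proof.
elim: p o x w => [|w' p IH] o x w.
  rewrite inE => zw; rewrite /= /gain_edge; case: ifP => _ /=;
  by rewrite ?(negPf zw).
rewrite inE negb_or => /andP[zw zp] /=.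
by have [-> ->] := IH (replace_primary o w w' x) w w' zp; rewrite /= (negPf zw).
Qed.

(** The new head is the predecessor of z on the walk; the default value of [last] makes it x at the
    start, which is where the inserted edge leads. *)
Lemma flip_walk_on o x w p p1 z p2 : uniq (w :: p) -> w :: p = p1 ++ z :: p2 ->
  let o' := flip_walk o x w p in let y := last x p1 in
  if p2 is z' :: _ then
    primary o' z = [seq if v == z' then y else v | v <- primary o z] /\
    secondary o' z = secondary o z
  else if outdeg o z < 2 then
    primary o' z = rcons (primary o z) y /\ secondary o' z = secondary o z
  else primary o' z = primary o z /\ secondary o' z = Some y.
Proof.
elim: p o x w p1 => [|w' p IH] o x w p1 u eq.
  case: p1 eq => [[<- <-]|a [|? ?] //] /=.
  rewrite /gain_edge; by case lt: (_ < 2) => /=; rewrite ?lt /= eqxx.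
case: p1 eq u => [[-> <-] u|a p1 [-> eq] u].
  have zp : z \notin w' :: p by case/andP: u.
  have [/= -> ->] := flip_walk_off (replace_primary o z w' x) z zp.
  by rewrite /= eqxx.
have za : (z == a) = false.
  apply: contraTF u => /eqP <-; by rewrite cons_uniq eq mem_cat inE eqxx orbT.
have up : uniq (w' :: p) by case/andP: u.
have := IH (replace_primary o a w' x) a w' p1 up eq.
by rewrite /= /outdeg /= za.
Qed.

End Orientation.

(** * Flipping a walk *)

Lemma mem_split (T : eqType) (x : T) s :
  x \in s -> exists p1 p2, s = p1 ++ x :: p2.
Proof. by case/splitPr=> p1 p2; exists p1, p2. Qed.

Lemma sorted_connect (T : finType) (r : rel T) q1 z q2 x :
  sorted r (q1 ++ z :: q2) -> x \in z :: q2 -> connect r z x.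
Proof. by case/cat_sorted2=> _ /= pz xz; apply: (path_connect pz). Qed.

Section Flip.
Variables (V : finType) (past es : seq (V * V)) (e : V * V) (v1 v2 : V).
Variables (o : orientation V) (p : seq V).
Hypotheses (F : forest_from past (e :: es)) (ne : name_ends past e = (v1, v2)).
Hypotheses (O : oriented past o) (pp : path (edge o) v1 p).

Let o' := flip_walk o v2 v1 p.
(** With v2 put in front, every edge created by the flip goes one position back in this list. *)
Let l := v2 :: v1 :: p.

Let gsym := @adj_sym V past.
Let girr := past_irr F.
Let gac := past_acyclic F.
Let dg := edge_adj O.
Let danti := edge_anti O.

Lemma named_disconnected : ~~ connect (adj past) v1 v2.
Proof.
have := forest_new F; case: (name_endsP ne) => _ [->|->] //=.
by rewrite conn_sym.
Qed.

Lemma walk_reach x : x \in v1 :: p -> connect (edge o) v1 x.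
Proof. by move=> xW; apply: (path_connect pp). Qed.

Lemma walk_conn x : x \in v1 :: p -> connect (adj past) v1 x.
Proof. by move/walk_reach; apply: reach_conn. Qed.

Lemma walk_uniq : uniq l.
Proof.
rewrite cons_uniq (dpath_uniq girr gac dg danti pp) andbT.
by apply: contra named_disconnected => /walk_conn.
Qed.

Section Split.
Variables (p1 p2 : seq V) (x : V).
Hypothesis eqW : v1 :: p = p1 ++ x :: p2.

Let eql : l = v2 :: p1 ++ x :: p2.
Proof. by rewrite /l eqW. Qed.

Lemma index_prev : index (last v2 p1) l = size p1.
Proof.
have -> : last v2 p1 = nth v2 l (size p1).
  by rewrite eql -cat_cons nth_cat /= ltnS leqnn (last_nth v2).
by rewrite index_uniq ?walk_uniq // eql /= size_cat ltnS leq_addr.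
Qed.

Lemma index_cur : index x l = (size p1).+1.
Proof.
have -> : x = nth v2 l (size p1).+1.
  by rewrite eql -cat_cons nth_cat /= ltnn subnn.
by rewrite index_uniq ?walk_uniq // eql /= size_cat !ltnS /= addnS ltnS leq_addr.
Qed.

Lemma index_succ z p3 : p2 = z :: p3 -> index z l = (size p1).+2.
Proof.
move=> eq2; have -> : z = nth v2 l (size p1).+2.
  by rewrite eql eq2 -cat_cons nth_cat /= ltnNge leqW // subSn // subnn.
by rewrite index_uniq ?walk_uniq // eql eq2 /= size_cat /= !addnS !ltnS leq_addr.
Qed.

(** The initial part of the walk joins the predecessor of x to v1 without meeting x, so no other
    neighbour of x can be picked. *)
Lemma prev_next_hop : last v2 p1 \in next_hop past v1 v2 x.
Proof.
have := pp; have := walk_uniq; rewrite /l eqW cons_uniq => /andP[_].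
case: p1 eqW => [[<- _]|a q [<- ep]] /=; first by rewrite /next_hop eqxx inE.
rewrite ep mem_cat inE !negb_or => /andP[/and3P[aq ax _]].
rewrite cat_uniq /= negb_or => /and3P[_ /andP[xq _] _].
rewrite cat_path /= => /and3P[pq lx _].
rewrite /next_hop eq_sym (negPf ax).
have ca : connect (avoid (adj past) x) (last v1 q) v1.
  rewrite (sym_connect_sym (avoid_sym gsym x)); apply/connectP; exists q => //.
  apply: path_avoid; first exact: sub_path dg _ _ pq.
  by rewrite inE negb_or eq_sym ax.
case: pickP => [y /andP[xy cy]|/(_ (last v1 q))]; last first.
  by rewrite ca gsym (dg lx).
rewrite inE; apply/eqP; apply: (neighbor_avoid_inj gsym girr gac (x := x)) => //.
  by rewrite gsym (dg lx).
by apply: connect_trans ca _; rewrite (sym_connect_sym (avoid_sym gsym x)).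
Qed.

Lemma prev_fresh : last v2 p1 \notin primary o x.
Proof.
have := pp; case: p1 eqW => [[<- _] _|a q [<- ep]] /=.
  apply/negP => /dg /connect1; exact/negP/named_disconnected.
by rewrite ep cat_path /= => /and3P[_ lx _]; apply: danti lx.
Qed.

End Split.

Definition next a b := (b \in l) && (index b l == (index a l).+1).

(** Separates old edges that the walk did not use from edges created by the flip; antisymmetry and
    [clean_child] rest on this distinction. *)
Lemma flip_edge x y : y \in primary o' x ->
  edge o x y && ~~ next x y \/
  [/\ x \in v1 :: p, next y x & y \in next_hop past v1 v2 x].
Proof.
have lW z : z \in v1 :: p -> z \in l by rewrite [in X in _ -> X]inE orbC => ->.
have [xW|xW] := boolP (x \in v1 :: p); last first.
  have [-> _] := flip_walk_off o v2 xW => xy; left.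
  rewrite /edge xy andTb /next; apply/negP => /andP[yl /eqP].
  have [x2|x2] := eqVneq x v2.
    rewrite x2 [index v2 l]/= eqxx => i1.
    have y1 : y = v1 by rewrite -(nth_index v2 yl) i1.
    move: xy; rewrite x2 y1 => /dg /connect1; rewrite conn_sym.
    exact/negP/named_disconnected.
  (* For a vertex outside the list, [index] is the length, and no entry lies beyond it. *)
  have /memNindex -> : x \notin l by rewrite inE negb_or x2.
  move=> iy; have : index y l <= size l by apply: index_size.
  by rewrite iy ltnn.
have [p1 [p2 eqW]] := mem_split xW.
have uW : uniq (v1 :: p) by have /andP[] := walk_uniq.
have := flip_walk_on o v2 uW eqW; rewrite /= -/o'.
have ix := index_cur eqW; have ip := index_prev eqW.
have nh := prev_next_hop eqW; have pf := prev_fresh eqW.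
have B : y = last v2 p1 -> [/\ true, next y x & y \in next_hop past v1 v2 x].
  by move->; split; rewrite // /next lW // ix ip andTb.
case: p2 eqW => [|z p2] eqW.
  have A : y \in primary o x -> edge o x y && ~~ next x y.
    rewrite /edge /next => ->; rewrite andTb; apply/negP => /andP[yl /eqP iy].
    by move: yl; rewrite -index_mem iy ix /l eqW /= size_cat addn1 ltnn.
  case: ifP => _ [-> _]; last by move=> /A H; left.
  by rewrite mem_rcons inE => /orP[/eqP/B|/A]; [right|left].
move=> [-> _] /mapP[v xv]; case: eqP => [_ /B|vz ->]; first by right.
left; rewrite /edge xv andTb; apply/negP => /andP[vl /eqP iv].
have iz := index_succ eqW (erefl _).
have zl : z \in l by rewrite lW // eqW mem_cat !inE eqxx !orbT.
by apply: vz; rewrite -(nth_index v2 vl) -(nth_index v2 zl) iz iv ix.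
Qed.

Lemma flip_shape x :
  [/\ uniq (primary o' x), size (primary o' x) <= 2,
      isSome (secondary o' x) -> size (primary o' x) = 2
    & isSome (secondary o' x) ->
      isSome (secondary o x) \/ x = last v1 p /\ 1 < outdeg o x].
Proof.
have ux := primary_uniq O x; have sx := primary_size O x.
have fx := secondary_full O (x := x).
have [xW|xW] := boolP (x \in v1 :: p); last first.
  by have [-> ->] := flip_walk_off o v2 xW; split => // ->; left.
have [p1 [p2 eqW]] := mem_split xW.
have uW : uniq (v1 :: p) by have /andP[] := walk_uniq.
have := flip_walk_on o v2 uW eqW; rewrite /= -/o'.
have pf := prev_fresh eqW.
case: p2 eqW => [|z p2] eqW.
  case: ifP => lt [-> ->].
    have s2 : (size (primary o x) < 2) && ~~ isSome (secondary o x).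
      move: lt fx; rewrite /outdeg; case: (secondary o x) => [?|] /= lt fx.
        by move: lt; rewrite fx.
      by rewrite andbT -(addn0 (size _)).
    have /andP[s2' ns] := s2.
    by split=> //; rewrite ?rcons_uniq ?pf ?size_rcons // => sec; rewrite sec in ns.
  have ge : 1 < outdeg o x by rewrite ltnNge -ltnS lt.
  split => // _; first exact: full_primary O ge.
  right; split => //.
  by rewrite -(last_cons v1) eqW last_cat.
move=> [-> ->]; rewrite size_map; split => //; last by move=> ->; left.
rewrite map_inj_in_uniq // => a b ax bx.
case: eqP => az; case: eqP => bz //; first by rewrite az bz.
  by move=> eb; rewrite -eb (negPf pf) in bx.
by move=> ea; rewrite ea (negPf pf) in ax.
Qed.

Lemma flip_mono x : isSome (secondary o x) -> isSome (secondary o' x).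
Proof.
have [xW|xW] := boolP (x \in v1 :: p); last first.
  by have [_ ->] := flip_walk_off o v2 xW.
have [p1 [p2 eqW]] := mem_split xW.
have uW : uniq (v1 :: p) by have /andP[] := walk_uniq.
have := flip_walk_on o v2 uW eqW; rewrite /= -/o'.
by case: p2 eqW => [|z p2] eqW; [case: ifP => lt|]; move=> [_ ->].
Qed.

Lemma flip_oriented : oriented (e :: past) o'.
Proof.
split.
- move=> x y /flip_edge[/andP[xy _]|[xW _ xy]]; rewrite /= mem_cat.
    by rewrite (primary_cand O xy) orbT.
  by rewrite ne /= conn_sym (walk_conn xW) xy.
- by move=> x; have [] := flip_shape x.
- by move=> x; have [] := flip_shape x.
- by move=> x; have [] := flip_shape x.
move=> x y /flip_edge xy; apply/negP => /flip_edge yx.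
case: xy yx => [/andP[xy n]|[xW n _]] [/andP[yx n']|[yW n' _]].
- by move: (danti xy); rewrite yx.
- by rewrite n' in n.
- by rewrite n in n'.
case/andP: n => _ /eqP i1; case/andP: n' => _ /eqP i2.
by move/eqP: i1; rewrite i2 ltn_eqF // ltnW.
Qed.

(** The flip changes only vertices of the walk, so walks from a clean vertex keep their law. *)
Definition clean c := forall z, connect (edge o) c z -> z \notin v1 :: p.

(** Reaching the walk at or before x would give a directed cycle. Reaching it after x would, by
    [child_unique], make c the successor of x on the walk. *)
Lemma clean_old x c : x \in v1 :: p -> edge o x c -> ~~ next x c -> clean c.
Proof.
move=> xW xc nxc z cz; apply/negP => zW.
have [p1 [p2 eqW]] := mem_split xW.
have zx : ~~ connect (edge o) z x.
  apply: contra (digraph_acyclic girr gac dg danti xc) => zx.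
  exact: connect_trans cz zx.
have sW : sorted (edge o) (v1 :: p) by exact: pp.
move: zW; rewrite eqW mem_cat inE => /or3P[z1|/eqP zx'|z2].
- have [q1 [q2 eq1]] := mem_split z1.
  case/negP: zx; apply: (@sorted_connect _ _ q1 z (q2 ++ x :: p2)).
    by rewrite -cat_cons catA -eq1 -eqW.
  by rewrite inE mem_cat inE eqxx !orbT.
- by rewrite zx' connect0 in zx.
case: p2 eqW z2 => // z' p2 eqW z2.
have sx : sorted (edge o) ((p1 ++ [:: x]) ++ z' :: p2) by rewrite -catA -eqW.
have xz' : edge o x z'.
  by move: sW; rewrite eqW => /cat_sorted2[_ /= /andP[]].
have cz' := child_unique gsym girr gac dg danti xc xz' cz (sorted_connect sx z2).
case/negP: nxc; rewrite cz' /next (index_succ eqW (erefl _)) (index_cur eqW).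
by rewrite eqxx inE eqW mem_cat !inE eqxx !orbT.
Qed.

Lemma walk_total a b : a \in v1 :: p -> b \in v1 :: p ->
  connect (edge o) a b \/ connect (edge o) b a.
Proof.
have sW : sorted (edge o) (v1 :: p) by exact: pp.
move=> aW; have [p1 [p2 eqW]] := mem_split aW; rewrite eqW in sW *.
rewrite mem_cat => /orP[b1|b2]; last by left; apply: sorted_connect sW b2.
right; have [q1 [q2 eq1]] := mem_split b1.
apply: (@sorted_connect _ _ q1 b (q2 ++ a :: p2)).
  by rewrite -cat_cons catA -eq1.
by rewrite inE mem_cat inE eqxx !orbT.
Qed.

Lemma clean_child x c0 c1 : primary o' x = [:: c0; c1] ->
  exists2 c, c \in [:: c0; c1] & edge o x c /\ clean c.
Proof.
move=> px; have [+ _ _ _] := flip_shape x; rewrite px /= inE andbT => c01.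
have [xW|xW] := boolP (x \in v1 :: p).
  have /flip_edge e0 : c0 \in primary o' x by rewrite px inE eqxx.
  have /flip_edge e1 : c1 \in primary o' x by rewrite px !inE eqxx orbT.
  case: e0 => [/andP[e0 n0]|[_ n0 _]].
    by exists c0; rewrite ?inE ?eqxx //; split=> //; apply: clean_old n0.
  case: e1 => [/andP[e1 n1]|[_ n1 _]].
    by exists c1; rewrite ?inE ?eqxx ?orbT //; split=> //; apply: clean_old n1.
  case/negP: c01; move: n0 n1; rewrite /next => /andP[xl /eqP i0] /andP[_ /eqP].
  rewrite i0 => /succn_inj i01.
  have c0l : c0 \in l.
    by rewrite -index_mem; apply: leq_trans (leqnSn _) _; rewrite -i0 index_mem.
  have c1l : c1 \in l by rewrite -index_mem -i01 index_mem.
  by rewrite -(nth_index v2 c0l) -(nth_index v2 c1l) i01.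
have [po _] := flip_walk_off o v2 xW; rewrite -/o' px in po.
have e0 : edge o x c0 by rewrite /edge -po inE eqxx.
have e1 : edge o x c1 by rewrite /edge -po !inE eqxx orbT.
have hyp c : {clean c} + {exists2 z, connect (edge o) c z & z \in v1 :: p}.
  case: (pickP [pred z | connect (edge o) c z && (z \in v1 :: p)]) => [z|no].
    by move=> /andP[cz zW]; right; exists z.
  by left=> z cz; have := no z; rewrite /= cz => /= ->.
case: (hyp c0) => [cl|[a c0a aW]].
  by exists c0; rewrite ?inE ?eqxx.
case: (hyp c1) => [cl|[b c1b bW]].
  by exists c1; rewrite ?inE ?eqxx ?orbT.
case/negP: c01; apply/eqP.
have cu := child_unique gsym girr gac dg danti e0 e1.
case: (walk_total aW bW) => [ab|ba].
  by apply: cu c1b; apply: connect_trans c0a ab.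
by apply: cu c0a _; apply: connect_trans c1b ba.
Qed.

End Flip.

(** * Walks in a fixed orientation *)

Local Open Scope ring_scope.

Definition avg (R : realFieldType) (T : finType) (f : T -> R) : R :=
  (\sum_t f t) / #|T|%:R.

(** * Averages over finite types *)

Section Average.
Variable R : realFieldType.
Implicit Types (T A : finType).

Lemma eq_avg T (f g : T -> R) : f =1 g -> avg f = avg g.
Proof. by move=> fg; rewrite /avg (eq_bigr g). Qed.

Lemma avg_le T (f g : T -> R) : (forall t, f t <= g t) -> avg f <= avg g.
Proof.
by move=> fg; rewrite ler_wpM2r ?invr_ge0 ?ler0n // ler_sum.
Qed.

Lemma avg_ge0 T (f : T -> R) : (forall t, 0 <= f t) -> 0 <= avg f.
Proof. by move=> f0; rewrite divr_ge0 ?ler0n // sumr_ge0. Qed.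

Lemma avgD T (f g : T -> R) : avg (fun t => f t + g t) = avg f + avg g.
Proof. by rewrite /avg big_split mulrDl. Qed.

Lemma avgZ T (c : R) (f : T -> R) : avg (fun t => c * f t) = c * avg f.
Proof. by rewrite /avg -mulr_sumr mulrA. Qed.

Lemma avg_sum T (I : Type) (s : seq I) (f : I -> T -> R) :
  avg (fun t => \sum_(i <- s) f i t) = \sum_(i <- s) avg (f i).
Proof. by rewrite /avg exchange_big mulr_suml. Qed.

Lemma avg_const T (c : R) : (0 < #|T|)%N -> avg (fun _ : T => c) = c.
Proof.
move=> T0; rewrite /avg sumr_const -[c *+ _]mulr_natr mulfK //.
by rewrite pnatr_eq0 -lt0n.
Qed.

(** On an empty type the average is 0, whence the inequality and the sign condition. *)
Lemma avg_const_le T (c : R) : 0 <= c -> avg (fun _ : T => c) <= c.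
Proof.
move=> c0; have [T0|T0] := posnP #|T|; last by rewrite avg_const.
by rewrite /avg T0 invr0 mulr0.
Qed.

Lemma avg_bool (f : bool -> R) : avg f = 2^-1 * (f false + f true).
Proof. by rewrite /avg card_bool big_bool addrC mulrC. Qed.

Lemma avg_tuple0 A (f : 0.-tuple A -> R) : avg f = f [tuple].
Proof.
rewrite /avg card_tuple expn0 divr1 (big_pred1 [tuple]) // => t.
by apply/esym/eqP; exact: tuple0.
Qed.

Lemma avg_tupleS n A (f : n.+1.-tuple A -> R) :
  avg f = avg (fun a => avg (fun t => f (cons_tuple a t))).
Proof.
rewrite /avg -mulr_suml -mulrA -invfM pair_big /= !card_tuple expnS natrM mulrC.
rewrite [RHS]mulrC (mulrC #|A|%:R); congr (_ * _).
rewrite (reindex (fun at' : A * n.-tuple A => cons_tuple at'.1 at'.2)) //.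
exists (fun t => (thead t, behead_tuple t)) => [[a t] _|t _] /=.
  by congr pair; apply: val_inj.
by case/tupleP: t => a t; apply: val_inj.
Qed.

End Average.

Section Walks.
Variables (R : realFieldType) (V : finType).
Implicit Types (o : orientation V) (x u : V).

Definition child o x (b : bool) : V := nth x (primary o x) b.

(** Branches that stop early are dropped: they always succeed, and without a volunteer. *)
Fixpoint tips o (j : nat) x : seq V :=
  if j is j'.+1 then
    if (outdeg o x < 2)%N then [::]
    else tips o j' (child o x false) ++ tips o j' (child o x true)
  else [:: x].

Fixpoint mgf (y : R) o (j : nat) x : R :=
  if j is j'.+1 then
    if (outdeg o x < 2)%N then 1
    else y / 2 * (mgf y o j' (child o x false) + mgf y o j' (child o x true))
  else 1.

Lemma avg_walkS o j x (h : seq V -> R) :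
  avg (fun bits : j.+1.-tuple bool => h (walk o x bits)) =
  if (outdeg o x < 2)%N then h [::]
  else 2^-1 *
    (avg (fun bits : j.-tuple bool =>
            h (child o x false :: walk o (child o x false) bits)) +
     avg (fun bits : j.-tuple bool =>
            h (child o x true :: walk o (child o x true) bits))).
Proof.
rewrite avg_tupleS; case: ifP => lt.
  rewrite (eq_avg (g := fun=> h [::])); first by rewrite avg_const ?card_bool.
  move=> b; rewrite -[RHS](@avg_const R (j.-tuple bool)) ?card_tuple ?card_bool ?expn_gt0 //.
  by apply: eq_avg => t; rewrite /= lt.
by rewrite avg_bool; congr (_ * (_ + _)); apply: eq_avg => t; rewrite /= lt.
Qed.

Lemma avg_mgf y o j x :
  avg (fun bits : j.-tuple bool => y ^+ size (walk o x bits)) = mgf y o j x.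
Proof.
elim: j x => [|j IH] x; first by rewrite avg_tuple0 /=; case: ifP.
rewrite (avg_walkS o j x (fun w => y ^+ size w)) /=; case: ifP => // _.
have E c : avg (fun bits : j.-tuple bool => y ^+ size (c :: walk o c bits)) =
    y * mgf y o j c.
  by rewrite -IH -avgZ; apply: eq_avg => t; rewrite -exprS.
by rewrite !E; field.
Qed.

Lemma avg_tips o j x (g : V -> R) :
  avg (fun bits : j.-tuple bool =>
         (size (walk o x bits) == j)%:R * g (last x (walk o x bits))) =
  (\sum_(u <- tips o j x) g u) / 2 ^+ j.
Proof.
elim: j x => [|j IH] x.
  by rewrite avg_tuple0 /= big_seq1 expr0 divr1; case: ifP; rewrite eqxx mul1r.
rewrite (avg_walkS o j x (fun w => (size w == j.+1)%:R * g (last x w))) /=.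
case: ifP => _; first by rewrite big_nil !mul0r.
have E c : avg (fun bits : j.-tuple bool =>
      (size (c :: walk o c bits) == j.+1)%:R * g (last c (walk o c bits))) =
      (\sum_(u <- tips o j c) g u) / 2 ^+ j.
  by rewrite -IH; apply: eq_avg => t; rewrite [size _]/= eqSS.
by rewrite !E big_cat exprS /=; field; rewrite expf_neq0 ?pnatr_eq0.
Qed.

Lemma child_edge past o x b : oriented past o -> ~~ (outdeg o x < 2)%N ->
  edge o x (child o x b).
Proof.
move=> O; rewrite -leqNgt => /(full_primary O) s2.
by apply: mem_nth; rewrite s2; case: b.
Qed.

Lemma child_neq past o x : oriented past o -> ~~ (outdeg o x < 2)%N ->
  child o x false != child o x true.
Proof.
move=> O; rewrite -leqNgt => /(full_primary O) s2.
by rewrite /child nth_uniq ?s2 // (primary_uniq O).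
Qed.

Lemma tips_reach past o j x u : oriented past o ->
  u \in tips o j x -> connect (edge o) x u.
Proof.
move=> O; elim: j x => [|j IH] x /=; first by rewrite inE => /eqP ->.
case: ifP => // /negbT ge; rewrite mem_cat.
have e b := connect1 (child_edge b O ge).
by case/orP=> /IH; apply: connect_trans.
Qed.

(** The two children of a vertex reach disjoint sets. Hence a full walk ends at a given vertex with
    probability at most 2 ^ (- j). *)
Lemma tips_uniq past es o j x : forest_from past es -> oriented past o ->
  uniq (tips o j x).
Proof.
move=> F O; elim: j x => [|j IH] x //=; case: ifP => // /negbT ge.
rewrite cat_uniq !IH /= andbT; apply/hasPn => u ut; apply/negP => uf.
have /eqP := child_neq O ge; apply.
apply: (child_unique (@adj_sym V past) (past_irr F) (past_acyclic F) (edge_adj O)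
          (edge_anti O) (child_edge false O ge) (child_edge true O ge)).
  exact: tips_reach O uf.
exact: tips_reach O ut.
Qed.

Lemma mgf_same y o o' j c :
  (forall z, connect (edge o) c z ->
     primary o' z = primary o z /\ secondary o' z = secondary o z) ->
  (forall z, connect (edge o) c z -> ~~ (outdeg o z < 2)%N -> forall b, edge o z (child o z b)) ->
  mgf y o' j c = mgf y o j c.
Proof.
move=> same ch.
suff H z : connect (edge o) c z -> mgf y o' j z = mgf y o j z by apply/H/connect0.
elim: j z => //= j IH z cz.
have [pz sz] := same z cz; rewrite /outdeg /child pz sz -/(outdeg o z).
case: ifP => // /negbT ge; have cb b := connect_trans cz (connect1 (ch z cz ge b)).
by rewrite !IH //; [exact: (cb true)|exact: (cb false)].
Qed.

Definition slow y past o : Prop := forall j x, mgf y o j x <= y ^+ (3 * crank past x).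

Lemma slow_start y : slow y [::] (no_edges V).
Proof. by move=> [|j] x. Qed.

(* The flipped walk can be reached from at most one child of a vertex of the
   tree of smaller rank r.  The other child keeps its old bound, and
   y / 2 * (y ^ (3 * r) + y ^ (3 * r')) <= y ^ (3 * r') for r < r'. *)
Lemma slow_flip y past es e v1 v2 o p : 1 <= y -> 2 * y <= 3 ->
  forest_from past (e :: es) -> name_ends past e = (v1, v2) ->
  oriented past o -> slow y past o -> path (edge o) v1 p ->
  slow y (e :: past) (flip_walk o v2 v1 p).
Proof.
move=> y1 y2 F ne O S pp; set o' := flip_walk _ _ _ _.
have O' : oriented (e :: past) o' := flip_oriented F ne O pp.
have mono x : y ^+ (3 * crank past x) <= y ^+ (3 * crank (e :: past) x).
  by rewrite ler_weXn2l // leq_mul2l crank_mono orbT.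
have same c j : (forall z, connect (edge o) c z -> z \notin v1 :: p) ->
    mgf y o' j c = mgf y o j c.
  move=> off; apply: mgf_same => z cz.
    exact: flip_walk_off (off z cz).
  by move=> ge b; apply: child_edge O ge.
elim=> [|j IH] x; first by rewrite /= exprn_ege1.
(* Outside the tree of v1, the flip alters nothing that x could reach. *)
have [xv1|xv1] := boolP (connect (adj past) x v1); last first.
  rewrite same => [|z /(reach_conn O) xz]; first by apply: le_trans (S _ _) (mono _).
  apply: contra xv1 => /(walk_conn O pp) vz.
  by apply: connect_trans xz _; rewrite conn_sym.
rewrite [X in X <= _]/=; case: ifP => [_|/negbT ge]; first by rewrite exprn_ege1.
have s2 : size (primary o' x) = 2%N by apply: full_primary O' _; rewrite leqNgt.
have IHc b : mgf y o' j (child o' x b) <= y ^+ (3 * crank (e :: past) x).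
  apply: le_trans (IH _) _; rewrite (crank_conn (y := x)) //.
  by rewrite conn_sym; apply/connect1/(edge_adj O')/(child_edge b O' ge).
have cl c : edge o x c -> clean v1 o p c ->
    mgf y o' j c <= y ^+ (3 * crank past x).
  move=> xc clc; rewrite same //; apply: le_trans (S _ _) _.
  by rewrite (@crank_conn _ past c x) // conn_sym connect1 ?(edge_adj O).
have step (a b : R) : a <= y ^+ (3 * crank past x) ->
    b <= y ^+ (3 * crank (e :: past) x) ->
    y / 2 * (a + b) <= y ^+ (3 * crank (e :: past) x).
  move=> ha hb; have := crank_touched ne xv1.
  move/subnKC => /(congr1 (muln 3)); set d := (_ - _)%N => ed.
  have {ha} ha : a * y ^+ 3 <= y ^+ (3 * crank (e :: past) x).
    rewrite -ed; apply: le_trans (_ : y ^+ (3 * crank past x) * y ^+ 3 <= _).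
      by rewrite ler_wpM2r // exprn_ge0 // (le_trans ler01).
    by rewrite -exprD ler_weXn2l //; lia.
  set B := y ^+ _ in hb ha *; have B0 : 0 <= B by rewrite exprn_ge0 // (le_trans ler01).
  have y3 : 0 < y ^+ 3 by rewrite exprn_gt0 // (lt_le_trans ltr01).
  (* The difference factors as y (y - 1) (1 + y - y ^ 2), and y <= 3/2 is below the golden ratio.
     Exponent 2 instead of 3 would require (y - 1) ^ 2 <= 0. *)
  have key : y * (1 + y ^+ 3) <= 2 * y ^+ 3.
    have : 0 <= y * (y - 1) * (1 + y - y ^+ 2).
      rewrite !mulr_ge0 //; nra.
    lra.
  rewrite -(ler_pM2r y3).
  have : y * (a * y ^+ 3 + b * y ^+ 3) <= y * (B + B * y ^+ 3).
    rewrite ler_wpM2l ?(le_trans ler01) // lerD // ler_wpM2r // ltW //.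
  have : B * (y * (1 + y ^+ 3)) <= B * (2 * y ^+ 3) by rewrite ler_wpM2l.
  lra.
have [c cin [xc cc]] : exists2 c, c \in [:: child o' x false; child o' x true] &
    edge o x c /\ clean v1 o p c.
  apply: (clean_child F ne O pp); rewrite -/o'.
  by move: s2; rewrite /child; case: (primary o' x) => [|a [|b []]].
move: cin xc cc; rewrite !inE => /orP[]/eqP -> xc cc.
  by apply: step; [apply: cl|apply: IHc].
by rewrite addrC; apply: step; [apply: cl|apply: IHc].
Qed.

End Walks.

(** * Counting the possible sets of end points *)

Local Open Scope nat_scope.

(* Contains every set of end points that walks of j moves from x can have, in
   any of the orientations that can arise. *)
Fixpoint leaves (V : finType) (past : seq (V * V)) (j : nat) (x : V) :
    seq (seq V) :=
  if j is j'.+1 then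
    let U := flatten [seq leaves past j' y | y <- cand past x] in
    [::] :: [seq s1 ++ s2 | s1 <- U, s2 <- U]
  else [:: [::]; [:: x]].

Section Leaves.
Variable V : finType.
Implicit Types (past es : seq (V * V)) (o : orientation V) (x : V).

(** The recursion is N' <= 1 + (K N) ^ 2. The extra factor q = (K + 1) ^ 2 makes the bound
    inductive, because 1 + K ^ 2 <= q. *)
Lemma size_leaves past j x K : (forall x, size (cand past x) <= K) ->
  size (leaves past j x) * K.+1 ^ 2 <= (2 * K.+1 ^ 2) ^ (2 ^ j).
Proof.
move=> sK; elim: j x => [|j IH] x; first by rewrite expn0 expn1.
rewrite [size _]/= size_allpairs.
set U := flatten _; set B := (2 * _) ^ _ in IH.
have sU : size U * K.+1 ^ 2 <= K * B.
  rewrite /U size_flatten /shape -map_comp.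
  apply: leq_trans (_ : size (cand past x) * B <= _); last by rewrite leq_mul2r sK orbT.
  elim: (cand past x) => //= y s IHs.
  by rewrite mulnDl mulSn leq_add.
have B0 : K.+1 ^ 2 <= B.
  by apply: leq_trans (IH x); rewrite leq_pmull //; case: (j).
rewrite [2 ^ j.+1]expnSr expnM -/B; move: sU B0; move: (size U) (B) => u B'.
rewrite -!mulnn; set q := K.+1 * K.+1 => uq qB'.
have : (u * q) * (u * q) <= (K * B') * (K * B') by rewrite leq_mul.
have : q * q <= B' * B' by rewrite leq_mul.
have q0 : 0 < q by rewrite muln_gt0.
move=> h1 h2; rewrite -(leq_pmul2r q0).
have -> : (u * u).+1 * q * q = q * q + u * q * (u * q) by nia.
apply: leq_trans (leq_add h1 h2) _.
have -> : B' * B' + K * B' * (K * B') = B' * B' * (1 + K * K) by nia.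
by rewrite leq_mul2l /q; apply/orP; right; nia.
Qed.

Lemma tips_leaves past o j x (P : pred V) : oriented past o ->
  filter P (tips o j x) \in leaves past j x.
Proof.
move=> O; elim: j x => [|j IH] x /=; first by case: ifP; rewrite !inE eqxx ?orbT.
case: ifP => [//|/negbT ge]; rewrite inE; apply/orP; right.
have U b : filter P (tips o j (child o x b)) \in
    flatten [seq leaves past j y | y <- cand past x].
  apply/flattenP; exists (leaves past j (child o x b)) => //.
  by apply: map_f; apply: (primary_cand O); apply: child_edge O ge.
rewrite filter_cat; apply/allpairsP.
exists (filter P (tips o j (child o x false)),
        filter P (tips o j (child o x true))).
by split => //=; apply: U.
Qed.

End Leaves.

(** * One insertion *)

Local Open Scope ring_scope.

(** For each t at most one [X t u] is nonzero, so the product has only terms of degree at most one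
    in X; averaging these and adding the missing nonnegative mixed terms gives the right side. It
    applies since an insertion has at most one volunteer. *)
Lemma avg_prod_exclusive (R : realFieldType) (T : finType) (V : eqType)
    (s : seq V) (f p : V -> R) (X : T -> V -> R) :
  uniq s -> (forall u, 0 <= f u) -> (forall t u, 0 <= X t u) ->
  (forall t u v, u != v -> X t u * X t v = 0) ->
  (forall u, avg (X^~ u) <= p u) ->
  avg (fun t => \prod_(u <- s) (f u + X t u)) <= \prod_(u <- s) (f u + p u).
Proof.
move=> us f0 X0 ex Xp; have p0 u : 0 <= p u.
  by apply: le_trans (Xp u); apply: avg_ge0.
elim: s us => [_|v s IH /= /andP[vs us]].
  under eq_avg do rewrite big_nil; rewrite big_nil.
  exact: avg_const_le.
have E t : \prod_(u <- v :: s) (f u + X t u) =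
    f v * \prod_(u <- s) (f u + X t u) + \prod_(u <- s) f u * X t v.
  rewrite big_cons mulrDl; congr (_ + _).
  elim: s vs {IH us} => [|w s IH]; first by rewrite !big_nil mulr1 mul1r.
  rewrite inE negb_or => /andP[vw /IH {}IH].
  rewrite !big_cons mulrCA IH mulrDl (mulrCA (X t w)) (mulrC (X t w)) ex //.
  by rewrite mulr0 addr0 mulrA.
rewrite (eq_avg E) avgD !avgZ big_cons mulrDl lerD //.
  by rewrite ler_wpM2l // IH.
rewrite mulrC; apply: ler_pM => //; first exact: avg_ge0.
  by rewrite prodr_ge0.
by apply: ler_prod => u _; rewrite f0 lerDl p0.
Qed.

Section Attempts.
Variables (R : realFieldType) (V : finType) (past es : seq (V * V)).
Variables (e : V * V) (v1 v2 : V) (o : orientation V) (k : costs) (L : nat).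
Hypotheses (F : forest_from past (e :: es)) (ne : name_ends past e = (v1, v2)).
Hypothesis O : oriented past o.

Lemma walk_path x bits : path (edge o) x (walk o x bits).
Proof.
elim: bits x => [|b bits IH] x /=; first by case: ifP.
by case: ifP => //= /negbT ge; rewrite IH (child_edge b O ge).
Qed.

Lemma walk_full (x : V) bits : (1 < outdeg o (last x (walk o x bits)))%N ->
  size (walk o x bits) = size bits.
Proof.
elim: bits x => [|b bits IH] x /=; first by case: ifP.
by case: ifP => [lt /=|_ /= /IH -> //]; rewrite ltnNge -ltnS lt.
Qed.

Lemma try_walks_some M (att : M.-tuple (L.-tuple bool)) o' :
  (try_walks k o v1 v2 att).2 = Some o' ->
  exists2 bits : L.-tuple bool, bits \in tval att &
    o' = flip_walk o v2 v1 (walk o v1 bits).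
Proof.
elim: (tval att) => //= bits s IH; case: ifP => _.
  by move=> [<-]; exists bits; rewrite ?inE ?eqxx.
case: try_walks IH => t r /= IH /IH[b bs ->].
by exists b; rewrite // inE bs orbT.
Qed.

Definition fail_rate : R :=
  (count (fun u => 2 < outdeg o u)%N (tips o L v1))%:R / 2 ^+ L.

Lemma avg_fail :
  avg (fun bits : L.-tuple bool => (~~ walk_succeeds o v1 (walk o v1 bits))%:R)
  = fail_rate.
Proof.
rewrite /fail_rate -sum1_count natr_sum [in RHS]big_mkcond /=.
rewrite -avg_tips; apply: eq_avg => bits.
rewrite /walk_succeeds -leqNgt; case: ifP => [gt|_]; last by rewrite mulr0.
by rewrite walk_full ?size_tuple ?eqxx ?mulr1 // ltnW.
Qed.

Lemma avg_all_fail M :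
  avg (fun att : M.-tuple (L.-tuple bool) =>
         (~~ isSome (try_walks k o v1 v2 att).2)%:R) = fail_rate ^+ M.
Proof.
elim: M => [|M IH]; first by rewrite avg_tuple0 expr0.
rewrite avg_tupleS exprS -IH -avg_fail mulrC -avgZ.
apply: eq_avg => bits; rewrite mulrC -avgZ; apply: eq_avg => att /=.
by case: ifP => _ /=; rewrite ?mul0r // mul1r; case: try_walks.
Qed.

Section Cost.
Variables (z : R) (kappa : nat).
Let y := z ^+ kappa.
Hypotheses (z1 : 1 <= z) (ytwo : y ^+ L.+1 <= 2) (good : 8 * fail_rate <= 1).
Hypotheses (kt : (try_cost k + flip_cost k <= kappa)%N)
  (km : (move_cost k + flip_cost k <= kappa)%N).

Let y_ge1 : 1 <= y. Proof. exact: exprn_ege1. Qed.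

Lemma mgf_ge1 j x : 1 <= mgf y o j x.
Proof.
elim: j x => //= j IH x; case: ifP => // _.
have := IH (child o x false); have := IH (child o x true).
have := y_ge1; set a := mgf _ _ _ _; set b := mgf _ _ _ _; nra.
Qed.

(* With w = y * mgf, the mean X of the cost satisfies
   X <= w + y ^ (L + 1) * fail_rate * (X - 1) <= w + (X - 1) / 4. *)
Lemma avg_try_cost M :
  avg (fun att : M.-tuple (L.-tuple bool) =>
         if (try_walks k o v1 v2 att).2 is Some _
         then z ^+ (try_walks k o v1 v2 att).1 else 0)
  <= (y * mgf y o L v1) ^+ 2.
Proof.
set G := mgf _ _ _ _; set w := y * G.
have w1 : 1 <= w by rewrite mulr_ege1 ?y_ge1 ?mgf_ge1.
(* The bound linear in w - 1 is the one kept by the induction; it is at most w ^ 2 because (w - 1) ^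
   2 >= 0. *)
suff : avg (fun att : M.-tuple (L.-tuple bool) =>
         if (try_walks k o v1 v2 att).2 is Some _
         then z ^+ (try_walks k o v1 v2 att).1 else 0) <= 1 + 2 * (w - 1).
  by move/le_trans; apply; nra.
elim: M => [|M IH]; first by rewrite avg_tuple0 /=; lra.
rewrite avg_tupleS.
have z0 : 0 <= z by apply: le_trans z1.
have y0 : 0 <= y by rewrite exprn_ge0.
(* A failed attempt makes all L moves and multiplies the bound 1 + 2 (w - 1) for the rest by y ^ (L
   + 1). The summand 1 goes into the first term. *)
pose bound bits := y * y ^+ size (walk o v1 bits) +
  (2 * (w - 1) * y ^+ L.+1) * (~~ walk_succeeds o v1 (walk o v1 bits))%:R.
apply: le_trans (avg_le (g := fun bits : L.-tuple bool => bound bits) _) _; last first.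
  rewrite avgD !avgZ avg_mgf avg_fail -/G -/w.
  have f0 : 0 <= fail_rate by rewrite divr_ge0 ?ler0n ?exprn_ge0.
  have : 8 * (y ^+ L.+1 * fail_rate) <= 2.
    rewrite mulrCA; apply: le_trans (_ : y ^+ L.+1 * 1 <= _); last by rewrite mulr1.
    by rewrite ler_wpM2l ?exprn_ge0.
  have : 0 <= y ^+ L.+1 * fail_rate by rewrite mulr_ge0 ?exprn_ge0.
  rewrite -[2 * _ * _ * _]mulrA; set q := _ * fail_rate; nra.
move=> bits; rewrite /bound -exprS.
have [suc|fail] := boolP (walk_succeeds _ _ _).
  rewrite mulr0 addr0.
  apply: le_trans (avg_le (g := fun=> y ^+ (size (walk o v1 bits)).+1) _) _.
    move=> att /=; rewrite suc /= -exprM ler_weXn2l //.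
    by move: kt km; set l := size _; nia.
  by rewrite avg_const_le ?exprn_ge0.
have sL : size (walk o v1 bits) = L.
  by rewrite walk_full ?size_tuple //; move: fail; rewrite /walk_succeeds -leqNgt => /ltnW.
rewrite mulr1 sL.
pose h (att : M.-tuple (L.-tuple bool)) := if (try_walks k o v1 v2 att).2 is Some _
         then z ^+ (try_walks k o v1 v2 att).1 else 0.
apply: le_trans (avg_le (g := fun att => y ^+ L.+1 * h att) _) _.
  move=> att /=; rewrite (negPf fail) /h; case: try_walks => t [o'|] /=; last by rewrite mulr0.
  rewrite exprD ler_wpM2r ?exprn_ge0 // sL -exprM ler_weXn2l //.
  by move: kt km; nia.
rewrite avgZ; have : 0 <= y ^+ L.+1 by rewrite exprn_ge0.
by move: IH; rewrite -/h; set H := avg _; set Y := y ^+ _; nra.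
Qed.

End Cost.

Definition volunteered M (att : M.-tuple (L.-tuple bool)) (u : V) : bool :=
  if (try_walks k o v1 v2 att).2 is Some o'
  then ~~ isSome (secondary o u) && isSome (secondary o' u) else false.

Lemma volunteered_inj M (att : M.-tuple (L.-tuple bool)) u v :
  volunteered att u -> volunteered att v -> u = v.
Proof.
rewrite /volunteered; case E: (_.2) => [o'|] //.
have [bits _ ->] := try_walks_some E.
have pp := walk_path v1 bits.
have fs := flip_shape F ne O pp.
move=> /andP[nu /(let: And4 _ _ _ h := fs u in h)[su|[-> _]]]; first by rewrite su in nu.
by move=> /andP[nv /(let: And4 _ _ _ h := fs v in h)[sv|[-> _]]] //; rewrite sv in nv.
Qed.

(** A union bound over the attempts: by [tips_uniq] each ends at u after L moves with probability at
    most 1 / 2 ^ L. *)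
Lemma avg_volunteered M u :
  avg (fun att : M.-tuple (L.-tuple bool) => (volunteered att u)%:R : R) <=
  if isSome (secondary o u) || ~~ connect (adj past) u v1 then 0
  else M%:R / 2 ^+ L.
Proof.
case: ifP => [no|_].
  rewrite (eq_avg (g := fun=> 0)) ?avg_const_le // => att.
  rewrite /volunteered; case E: (_.2) => [o'|] //.
  have [bits _ ->] := try_walks_some E.
  have pp := walk_path v1 bits.
  case/orP: no => [->//|nc]; case: (boolP (_ && _)) => // /andP[nu su].
  have [_ _ _ /(_ su)[su'|[ul _]]] := flip_shape F ne O pp u.
    by rewrite su' in nu.
  case/negP: nc; rewrite conn_sym ul; apply: (walk_conn O pp).
  exact: mem_last.
elim: M => [|M IH]; first by rewrite avg_tuple0 /= mul0r.
pose h (bits : L.-tuple bool) : R :=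
  (size (walk o v1 bits) == L)%:R * (last v1 (walk o v1 bits) == u)%:R.
have h1 : avg h <= 1 / 2 ^+ L.
  rewrite /h (avg_tips o L v1 (fun w => (w == u)%:R)) ler_wpM2r ?invr_ge0 ?exprn_ge0 //.
  rewrite -natr_sum -[1]/(1%:R) ler_nat.
  have -> : (\sum_(w <- tips o L v1) (w == u))%N = count_mem u (tips o L v1).
    by rewrite -sum1_count [RHS]big_mkcond; apply: eq_bigr => w _ /=; case: eqP.
  by rewrite count_uniq_mem ?leq_b1 //; apply: tips_uniq F O.
rewrite avg_tupleS -natr1 mulrDl addrC.
apply: le_trans (_ : avg h + avg (fun att : M.-tuple (L.-tuple bool) => (volunteered att u)%:R) <= _);
  last by rewrite lerD.
rewrite -[X in _ + X](@avg_const _ (L.-tuple bool)) ?card_tuple ?card_bool ?expn_gt0 // -avgD.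
apply: avg_le => bits.
rewrite -[X in X + _](@avg_const _ (M.-tuple (L.-tuple bool))) ?card_tuple ?card_bool ?expn_gt0 // -avgD.
apply: avg_le => att.
have h0 : 0 <= h bits by rewrite mulr_ge0 ?ler0n.
rewrite /volunteered /=; case: ifP => /= _; last by case: try_walks => t r /=; rewrite lerDr.
apply: ler_wpDr; first by rewrite ler0n.
case: (boolP (_ && _)) => // /andP[nu su].
have [_ _ _ /(_ su)[su'|[ul ou]]] := flip_shape F ne O (walk_path v1 bits) u.
  by rewrite su' in nu.
by rewrite /h -ul eqxx walk_full ?size_tuple ?eqxx ?mulr1 -?ul.
Qed.

Section Potential.
Variables (K M : nat).
Hypothesis rankK : forall u, (crank (e :: past) u <= K)%N.

(* Bounds the probability that u ever has a secondary edge: each of the at most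
   K - crank u further insertions that touch the tree of u makes it volunteer
   with probability at most M / 2 ^ L. *)
Definition phi (past' : seq (V * V)) (o' : orientation V) (u : V) : R :=
  if isSome (secondary o' u) then 1
  else M%:R / 2 ^+ L * (K - crank past' u)%:R.

Lemma phi_ge0 past' o' u : 0 <= phi past' o' u.
Proof. by rewrite /phi; case: ifP; rewrite // !mulr_ge0 ?invr_ge0 ?exprn_ge0 ?ler0n. Qed.

(** The supermartingale step. If u lies in the tree of v1, its rank grows, and the drop of
    [K - crank] makes room for the chance M / 2 ^ L of volunteering now. *)
Lemma avg_phi s : uniq s ->
  avg (fun att : M.-tuple (L.-tuple bool) =>
         if (try_walks k o v1 v2 att).2 is Some o'
         then \prod_(u <- s) phi (e :: past) o' u else 0) <=
  \prod_(u <- s) phi past o u.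
Proof.
move=> us; pose X (att : M.-tuple (L.-tuple bool)) u : R := (volunteered att u)%:R.
have q0 : 0 <= M%:R / 2 ^+ L :> R by rewrite !mulr_ge0 ?invr_ge0 ?exprn_ge0 ?ler0n.
have p0 := phi_ge0.
apply: le_trans (avg_le (g := fun att => \prod_(u <- s) (phi (e :: past) o u + X att u)) _) _.
  move=> att; case E: (_.2) => [o'|]; last first.
    by apply: prodr_ge0 => u _; rewrite addr_ge0 ?ler0n.
  apply: ler_prod => u _; rewrite p0 /= /X /volunteered E.
  have [bits _ Eo'] := try_walks_some E.
  have := flip_mono F ne O (walk_path v1 bits) (x := u); rewrite -Eo'.
  have := q0; rewrite /phi; case: (isSome (secondary o u)) => [|] /= _.
    by move=> /(_ isT) ->; rewrite /= lerDl ler0n.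
  by case: ifP => _ _ /=; rewrite ?addr0 // lerDr mulr_ge0 ?ler0n.
apply: le_trans (avg_prod_exclusive (p := fun u =>
  if isSome (secondary o u) || ~~ connect (adj past) u v1 then 0
  else M%:R / 2 ^+ L) us (p0 _ _) _ _ _) _.
- by move=> att u; rewrite ler0n.
- move=> att u v uv; rewrite /X -natrM mulnb; case: (boolP (_ && _)) => // /andP[vu vv].
  by rewrite (volunteered_inj vu vv) eqxx in uv.
- by move=> u; apply: avg_volunteered.
apply: ler_prod => u _; apply/andP; split.
  by rewrite addr_ge0 //; case: ifP.
have cm := crank_mono e past u; have ck := rankK u; have ct := @crank_touched _ e past _ _ u ne.
move: cm ck ct; rewrite /phi; set c' := crank (e :: past) u => cm ck ct.
case: (isSome _) => /=; first by rewrite addr0.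
case: ifPn => [nc|/negPn c].
  by rewrite addr0 ler_wpM2l // ler_nat leq_sub2l.
rewrite -[X in _ + X]mulr1 -mulrDr ler_wpM2l // -[1]/(1%:R) -natrD ler_nat.
by have := ct c; move: ck; lia.
Qed.

End Potential.
End Attempts.

(** * The whole sequence *)

Local Open Scope nat_scope.

(* The sets whose complete volunteering could make an insertion of es likely
   to fail. *)
Fixpoint dangerous (V : finType) (m L : nat) (past es : seq (V * V)) :
    seq (seq V) :=
  if es is e :: es' then
    [seq s <- leaves past L (name_ends past e).1 | uniq s && (m <= size s)]
    ++ dangerous m L (e :: past) es'
  else [::].

(** [acc] is the time spent on earlier edges; it lets the induction pass to the remaining ones. *)
Definition overruns (V : finType) (M L : nat) (k : costs) (B acc : nat)
    (past : seq (V * V)) (o : orientation V) (es : seq (V * V))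
    (omega : seq (M.-tuple (L.-tuple bool))) : bool :=
  let: (t, final) := run_from k past o es omega in
  ~~ (isSome final && (acc + t <= B)).

Local Open Scope ring_scope.

Section Run.
Variables (R : realFieldType) (V : finType) (k : costs) (M L m kappa B : nat).
Variable z : R.
Let y := z ^+ kappa.
Let K := trunc_log 2 #|V|.
Hypotheses (z1 : 1 <= z) (y2 : y ^+ L.+1 <= 2) (y3 : 2 * y <= 3).
Hypotheses (kr : (rank_cost k <= kappa)%N)
  (kt : (try_cost k + flip_cost k <= kappa)%N)
  (km : (move_cost k + flip_cost k <= kappa)%N).
Hypothesis mL : (8 * m <= 2 ^ L)%N.

Lemma dangerous_uniq (past es : seq (V * V)) s :
  s \in dangerous m L past es -> uniq s /\ (m <= size s)%N.
Proof.
elim: es past => //= e es IH past; rewrite mem_cat => /orP[|/IH//].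
by rewrite mem_filter => /andP[/andP[]].
Qed.

Notation weight past o s := (\prod_(u <- s) @phi R V L K M past o u).

Lemma weight_ge0 (past : seq (V * V)) (o : orientation V) (s : seq V) : 0 <= weight past o s.
Proof. by apply: prodr_ge0 => u _; apply: phi_ge0. Qed.

(** The end points of out-degree 3 form a dangerous set whose vertices have all volunteered, so its
    weight is already 1. *)
Lemma bad_weight past es e v1 v2 o :
  forest_from past (e :: es) -> oriented past o ->
  name_ends past e = (v1, v2) -> 1 < 8 * fail_rate R v1 o L ->
  1 <= \sum_(s <- dangerous m L past (e :: es)) weight past o s.
Proof.
move=> F O ne; rewrite /fail_rate mulrA ltr_pdivlMr ?exprn_gt0 // mul1r.
rewrite -natrX -natrM ltr_nat => many.
set s0 := [seq u <- tips o L v1 | (2 < outdeg o u)%N].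
have s0in : s0 \in dangerous m L past (e :: es).
  rewrite /= ne mem_cat mem_filter /= tips_leaves // andbT filter_uniq ?(tips_uniq _ _ F O) //=.
  by rewrite size_filter; apply/orP; left; move: many mL; lia.
have w1 : weight past o s0 = 1.
  rewrite big_seq big1 // => u; rewrite mem_filter /phi /outdeg.
  case: (secondary o u) => //= /andP[+ _]; rewrite addn0.
  by have := primary_size O u; case: size => [|[|[|?]]].
rewrite (big_rem s0) //= w1 lerDl sumr_ge0 // => s _; exact: weight_ge0.
Qed.

(** The three terms cover insertions with failure rate above 1/8, failure of all M attempts at a
    rate of at most 1/8, and Markov's inequality for the cost. *)
Lemma run_bound past o es acc : forest_from past es -> oriented past o ->
  slow y past o ->
  avg (fun omega : (size es).-tuple (M.-tuple (L.-tuple bool)) =>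
         (overruns k B acc past o es omega)%:R) <=
  \sum_(s <- dangerous m L past es) weight past o s
  + (size es)%:R * 8^-1 ^+ M + z ^+ acc * y ^+ (7 * rank_sum past es) / z ^+ B.
Proof.
have z0 : 0 < z by apply: lt_le_trans z1.
have y1 : 1 <= y by apply: exprn_ege1.
have y0 : 0 < y by apply: lt_le_trans y1.
have z0w := ltW z0; have y0w := ltW y0.
have e80 : 0 <= 8^-1 ^+ M :> R by rewrite exprn_ge0 // invr_ge0.
elim: es past o acc => [|e es IH] past o acc F O S.
  rewrite avg_tuple0 /= big_nil mul0r !add0r muln0 expr0 mulr1 /overruns /= addn0.
  case: leqP => [_|lt]; first by rewrite divr_ge0 // exprn_ge0.
  by rewrite ler_pdivlMr ?exprn_gt0 // mul1r ler_weXn2l // ltnW.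
case ne : (name_ends past e) => [v1 v2].
(* In the bad case the first sum is at least 1 and the claim is trivial. *)
have [bad|good] := ltP 1 (8 * fail_rate R v1 o L).
  apply: le_trans (avg_le (g := fun=> 1) _) _; first by move=> w; case: overruns.
  apply: le_trans (avg_const_le _ _) _ => //.
  have := bad_weight F O ne bad; set W := \sum_(s <- _) _ => W1.
  have t2 : 0 <= (size (e :: es))%:R * 8^-1 ^+ M :> R by rewrite mulr_ge0.
  have t3 : 0 <= z ^+ acc * y ^+ (7 * rank_sum past (e :: es)) / z ^+ B.
    by rewrite divr_ge0 ?mulr_ge0 ?exprn_ge0.
  by move: W1 t2 t3; lra.
pose tr := (rank_cost k * (1 + minn (crank past v1) (crank past v2)))%N.
pose res (att : M.-tuple (L.-tuple bool)) := try_walks k o v1 v2 att.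
pose c := z ^+ (acc + tr) * y ^+ (7 * rank_sum (e :: past) es) / z ^+ B.
have c0 : 0 <= c by rewrite divr_ge0 ?mulr_ge0 ?exprn_ge0.
have F' := forest_step F.
have rk u : (crank (e :: past) u <= K)%N by apply: forest_crank F'.
rewrite [size _]/= avg_tupleS.
(* Failure now, weights of later dangerous sets, later failures, and cost. The cost part is 0 upon
   failure, which the first part counts. *)
pose G (att : M.-tuple (L.-tuple bool)) : R := (~~ isSome (res att).2)%:R
  + \sum_(s <- dangerous m L (e :: past) es)
      (if (res att).2 is Some o' then weight (e :: past) o' s else 0)
  + (size es)%:R * 8^-1 ^+ M
  + c * (if (res att).2 is Some _ then z ^+ (res att).1 else 0).
apply: le_trans (avg_le (g := G) _) _.
  move=> att; rewrite /G; case E : (res att).2 => [o'|] /=.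
    rewrite /c /= add0r.
    have [bits _ Eo'] := try_walks_some E.
    have pp := walk_path O v1 bits.
    have O' : oriented (e :: past) o' by rewrite Eo'; apply: flip_oriented F ne O pp.
    have S' : slow y (e :: past) o' by rewrite Eo'; apply: slow_flip F ne O S pp.
    have := IH (e :: past) o' (acc + tr + (res att).1)%N F' O' S'.
    rewrite exprD; set A := \sum_(s <- _) _ => H.
    apply: le_trans (_ : _ <= A + _ * _ + z ^+ (acc + tr) * z ^+ (res att).1 *
       y ^+ (7 * rank_sum (e :: past) es) / z ^+ B) _; last first.
      by rewrite !lerD // le_eqVlt; apply/orP; left; apply/eqP; ring.
    apply: le_trans H; apply: avg_le => w.
    rewrite /overruns /= ne /=; move: E; rewrite /res.
    case: try_walks => t r /= ->; case: run_from => t' f /=.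
    by rewrite /tr !addnA.
  rewrite big1 // addr0 mulr0 addr0.
  apply: le_trans (avg_le (g := fun=> 1) _) _; first by move=> w; case: overruns.
  apply: le_trans (avg_const_le _ _) _ => //.
  by rewrite lerDl mulr_ge0.
rewrite /G !avgD avgZ avg_sum.
have h1 : avg (fun att => (~~ isSome (res att).2)%:R) <= 8^-1 ^+ M :> R.
  rewrite (avg_all_fail R v1 v2 o k L M) lerXn2r ?nnegrE ?invr_ge0 //.
    by rewrite divr_ge0 ?exprn_ge0.
  by move: good; set f := fail_rate _ _ _ _; lra.
have h2 : \sum_(s <- dangerous m L (e :: past) es) avg (fun att =>
      if (res att).2 is Some o' then weight (e :: past) o' s else 0) <=
    \sum_(s <- dangerous m L past (e :: es)) weight past o s.
  rewrite [dangerous m L past _]/= big_cat /=.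
  apply: ler_wpDl; first by rewrite sumr_ge0 // => s _; apply: weight_ge0.
  rewrite !big_seq; apply: ler_sum => s /dangerous_uniq[us _].
  exact: (avg_phi R k L F ne O M rk us).
have h3 : avg (fun _ : M.-tuple (L.-tuple bool) => (size es)%:R * 8^-1 ^+ M) <= (size es)%:R * 8^-1 ^+ M :> R.
  by apply: avg_const_le; rewrite mulr_ge0.
have m0 : 0 <= mgf y o L v1 by apply: le_trans (mgf_ge1 o kappa z1 L v1).
have h4 : c * avg (fun att => if (res att).2 is Some _ then z ^+ (res att).1 else 0)
   <= z ^+ acc * y ^+ (7 * rank_sum past (e :: es)) / z ^+ B.
  apply: le_trans (_ : c * (y * mgf y o L v1) ^+ 2 <= _).
    by rewrite ler_wpM2l //; apply: avg_try_cost.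
  rewrite /c mulrAC ler_wpM2r ?invr_ge0 ?exprn_ge0 //.
  rewrite exprD -!mulrA ler_wpM2l ?exprn_ge0 //.
  (* With r = [crank past v1], the ranks cost 1 + r and the walks 2 (1 + 3 r), in total at most 7 (r
     + 1). *)
  apply: le_trans (_ : y ^+ (1 + crank past v1) * (y ^+ (7 * rank_sum (e :: past) es)
     * (y * y ^+ (3 * crank past v1)) ^+ 2) <= _).
    apply: ler_pM; first exact: exprn_ge0.
    - by rewrite mulr_ge0 ?exprn_ge0 // mulr_ge0.
    - by rewrite /y -exprM ler_weXn2l // /tr leq_mul // leq_add2l geq_minl.
    rewrite ler_wpM2l ?exprn_ge0 // lerXn2r ?nnegrE ?ler_pM2l //.
      by rewrite mulr_ge0.
    by rewrite mulr_ge0 ?exprn_ge0.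
  have -> : rank_sum past (e :: es) =
      ((crank past v1).+1 + rank_sum (e :: past) es)%N by rewrite [LHS]/= ne.
  rewrite -exprS -exprM -!exprD; apply: ler_weXn2l => //.
  by move: (rank_sum _ _) (crank _ _) => a b; clear; lia.
have -> : (size (e :: es))%:R * 8^-1 ^+ M =
    8^-1 ^+ M + (size es)%:R * 8^-1 ^+ M :> R by rewrite /= -natr1; ring.
move: h1 h2 h3 h4.
set a1 := avg _; set a2 := \sum_(s <- _) avg _; set a3 := avg _.
set a4 := c * _; set a5 := \sum_(s <- _) _; set a6 := _ ^+ M.
set a7 := _ / _; set a8 := _%:R * _.
by lra.
Qed.

End Run.

Local Open Scope nat_scope.

(** * The probability bound for explicit parameters *)

Section FiniteBound.
Variables (R : realType) (V : finType).
Let n := #|V|.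
Let K := trunc_log 2 n.

Lemma size_dangerous m L (past es : seq (V * V)) : forest_from past es ->
  size (dangerous m L past es) <= size es * (2 * K.+1 ^ 2) ^ (2 ^ L).
Proof.
elim: es past => //= e es IH past F; rewrite size_cat mulSn.
apply: leq_add (IH _ (forest_step F)); rewrite size_filter.
apply: leq_trans (count_size _ _) _.
have sc x : size (cand past x) <= K.
  exact: leq_trans (size_cand past x) (forest_crank x F).
apply: leq_trans (size_leaves L (name_ends past e).1 sc).
by rewrite leq_pmulr // expn_gt0.
Qed.

Local Open Scope ring_scope.

Lemma no_edges_oriented : oriented [::] (no_edges V).
Proof. by split. Qed.

Lemma weight_start (m M L : nat) (es : seq (V * V)) : forest_from [::] es ->
  M%:R / 2 ^+ L * K%:R <= 1 :> R ->
  \sum_(s <- dangerous m L [::] es)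
     \prod_(u <- s) @phi R V L K M [::] (no_edges V) u <=
  (size es * (2 * K.+1 ^ 2) ^ (2 ^ L))%:R * (M%:R / 2 ^+ L * K%:R) ^+ m.
Proof.
move=> F; set q := _ * K%:R => q1.
have q0 : 0 <= q by rewrite !mulr_ge0 ?invr_ge0 ?exprn_ge0.
apply: le_trans (_ : (size (dangerous m L [::] es))%:R * q ^+ m <= _); last first.
  by rewrite ler_wpM2r ?exprn_ge0 // ler_nat size_dangerous.
rewrite -sum1_size natr_sum mulr_suml !big_seq; apply: ler_sum => s.
move=> /dangerous_uniq[_ ms]; rewrite mul1r /phi /= subn0 -/q.
by rewrite big_const_seq count_predT iter_mulr_1 ler_wiXn2l.
Qed.

Lemma bernoulli_ge (x : R) j : 0 <= x -> 1 + x *+ j <= (1 + x) ^+ j.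
Proof.
move=> x0; elim: j => [|j IH]; first by rewrite mulr0n addr0.
rewrite exprS mulrSr; apply: le_trans (_ : (1 + x) * (1 + x *+ j) <= _).
  have : 0 <= x *+ j by rewrite mulrn_wge0.
  by set t := x *+ j; nra.
by rewrite ler_wpM2l // addr_ge0.
Qed.

Lemma bernoulli_le (x : R) j : 0 <= x -> 2 * (x *+ j) <= 1 -> (1 + x) ^+ j <= 2.
Proof.
move=> x0 hx.
(* Inductive because (1 + x) (1 - (i + 1) x) <= 1 - i x; at j the second factor is at least 1/2. *)
suff : forall i, (i <= j)%N -> (1 + x) ^+ i * (1 - x *+ i) <= 1.
  move=> /(_ j (leqnn _)); have : 0 <= (1 + x) ^+ j by rewrite exprn_ge0 // addr_ge0.
  by move: hx; set t := x *+ j; set p := _ ^+ j; nra.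
elim=> [|i IH] ij; first by rewrite mulr0n subr0 mulr1.
apply: le_trans (IH (ltnW ij)); rewrite exprSr -mulrA ler_wpM2l ?exprn_ge0 ?addr_ge0 //.
rewrite mulrSr; have : 0 <= x *+ i by rewrite mulrn_wge0.
by set t := x *+ i; nra.
Qed.

Lemma Pr_avg (T : finType) (E : pred T) :
  (0 < #|T|)%N -> Pr R E = 1 - avg (fun t => (~~ E t)%:R).
Proof.
move=> T0; rewrite -[X in X - _](@avg_const R T) // /avg -mulrBl -sumrB.
rewrite /Pr; congr (_ / _); rewrite -sum1_card natr_sum big_mkcond.
by apply: eq_bigr => t _; rewrite inE; case: (E t); rewrite ?subr0 ?subrr.
Qed.

(** Each of the three terms of [run_bound] is made at most a quarter of the allowed failure
    probability. *)
Lemma dancing_walk_bound (k : costs) (kappa M L A : nat) (es : seq (V * V)) :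
  kappa = (rank_cost k + try_cost k + move_cost k + flip_cost k).+1 ->
  forms_tree es -> (0 < n)%N -> (2 < L)%N ->
  (2 * (2 * K.+1 ^ 2) ^ 8 * K * M <= 2 ^ L)%N ->
  (8 * (K.+1 * A.+1 + 2) <= 2 ^ L)%N ->
  (K.+1 * A.+1 + 2 <= 3 * M)%N ->
  (L.+1 * (K.+1 * A + 2) <= n)%N ->
  1 - 2^-1 ^+ (K.+1 * A) <=
  Pr R (fun omega : randomness n.-1 M L =>
          performs_within k es ((16 * kappa)%:R * n%:R : R) omega).
Proof.
move=> kE tree n0 L2 c1 c2 c3 c4.
have k0 : (0 < kappa)%N by rewrite kE.
have F := forest_start tree.
have szes : size es = n.-1 by case: tree.
pose m := (2 ^ (L - 3))%N.
have mL : (8 * m = 2 ^ L)%N by rewrite -[8%N]/(2 ^ 3)%N -expnD subnKC.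
(* Chosen so that y ^ (L + 1) = (1 + 1 / Z) ^ (Z / 2), which is at most 2, while z ^ Z >= 2. *)
pose Z := (2 * (kappa * L.+1))%N.
have Z0 : (0 < Z)%N by rewrite /Z !muln_gt0 k0.
pose z : R := 1 + Z%:R^-1; pose y := z ^+ kappa.
have iZ0 : 0 <= Z%:R^-1 :> R by rewrite invr_ge0.
have z1 : 1 <= z by rewrite lerDl.
have y2 : y ^+ L.+1 <= 2.
  rewrite -exprM; apply: bernoulli_le => //.
  by rewrite -[_ *+ (_ * _)]mulr_natr mulrCA -natrM mulVf // pnatr_eq0 -lt0n.
have y1 : 1 <= y by apply: exprn_ege1.
have y3 : 2 * y <= 3.
  have : y ^+ 2 <= 2.
    by apply: le_trans y2; rewrite ler_weXn2l // ltnS ltnW // ltnW.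
  by nra.
have z2 : 2 <= z ^+ Z.
  apply: le_trans (bernoulli_ge _ iZ0).
  by rewrite -[_ *+ Z]mulr_natr mulVf ?pnatr_eq0 // -lt0n.
have card0 : (0 < #|randomness n.-1 M L|)%N.
  by rewrite !card_tuple card_bool !expn_gt0.
rewrite Pr_avg // lerD2l lerN2.
have -> : avg (fun omega : randomness n.-1 M L =>
    (~~ performs_within k es ((16 * kappa)%:R * n%:R : R) omega)%:R) =
  avg (fun omega : (size es).-tuple (M.-tuple (L.-tuple bool)) =>
    (overruns k (16 * kappa * n) 0 [::] (no_edges V) es omega)%:R) :> R.
  rewrite szes; apply: eq_avg => omega; rewrite /performs_within /overruns /dancing_walk.
  by case: run_from => t f; rewrite add0n -natrM ler_nat.
have kr : (rank_cost k <= kappa)%N by rewrite kE; clear; lia.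
have kt : (try_cost k + flip_cost k <= kappa)%N by rewrite kE; clear; lia.
have km : (move_cost k + flip_cost k <= kappa)%N by rewrite kE; clear; lia.
have mL' : (8 * m <= 2 ^ L)%N by rewrite mL.
apply: le_trans (run_bound M (16 * kappa * n) z1 y2 y3 kr kt km mL' 0 F no_edges_oriented
  (@slow_start R V y)) _.
have two0 : 0 < 2 :> R by [].
have e2 i : 2 ^+ i = (2 ^ i)%:R :> R by rewrite natrX.
have eT i j : (i <= j)%N -> 2^-1 ^+ j <= 2^-1 ^+ i :> R.
  by move=> ij; rewrite ler_wiXn2l // ?invr_ge0 // invf_le1 // ler1n.
(* As n < 2 ^ (K + 1), a union bound over the insertions costs K + 1 in the exponent. *)
have nK : n%:R * 2^-1 ^+ (K.+1 * A.+1 + 2) <= 2^-1 ^+ (K.+1 * A + 2) :> R.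
  have -> : (K.+1 * A.+1 + 2 = K.+1 + (K.+1 * A + 2))%N by rewrite mulnS addnA.
  rewrite exprD mulrA ler_piMl ?exprn_ge0 ?invr_ge0 //.
  rewrite exprVn ler_pdivrMr ?exprn_gt0 // mul1r e2 ler_nat ltnW //.
  by rewrite /K trunc_log_ltn.
have es_n : (size es <= n)%N by rewrite szes leq_pred.
set T := (K.+1 * A)%N in nK *.
have e4 : 2^-1 ^+ (T + 2) = 4^-1 * 2^-1 ^+ T :> R by rewrite exprD mulrC; congr (_ * _); field.
have h2 : (size es)%:R * 8^-1 ^+ M <= 2^-1 ^+ (T + 2) :> R.
  apply: le_trans nK; apply: ler_pM; rewrite ?exprn_ge0 ?invr_ge0 ?ler_nat //.
  have -> : 8^-1 = 2^-1 ^+ 3 :> R by field.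
  by rewrite -exprM eT.
have h3 : z ^+ 0 * y ^+ (7 * rank_sum [::] es) / z ^+ (16 * kappa * n) <= 2^-1 ^+ (T + 2).
  have z0 : 0 < z by apply: lt_le_trans z1.
  have z0w := ltW z0.
  (* By [rank_sum_linear] the moment is at most y ^ (14 n). The remaining exponent 2 kappa n is at
     least Z (T + 2). *)
  have zy : z ^+ (16 * kappa * n) = y ^+ (14 * n) * z ^+ (2 * kappa * n).
    by rewrite /y -exprM -exprD; congr (_ ^+ _); clear; lia.
  rewrite expr0 mul1r zy invfM mulrA.
  apply: le_trans (_ : (z ^+ (2 * kappa * n))^-1 <= _).
    rewrite ler_piMl ?invr_ge0 ?exprn_ge0 //.
    rewrite ler_pdivrMr ?exprn_gt0 // mul1r ler_weXn2l //.
    by have := rank_sum_linear F; rewrite -/n; move: (rank_sum _ _) (n) => r n'; clear; lia.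
  rewrite exprVn lef_pV2 ?posrE ?exprn_gt0 //.
  apply: le_trans (_ : (z ^+ Z) ^+ (T + 2) <= _).
    by rewrite lerXn2r ?nnegrE // exprn_ge0.
  by rewrite -exprM ler_weXn2l // /Z; move: c4; rewrite -/T; move: (T) (n) (L) => T' n' L'; clear; nia.
have h1 : \sum_(s <- dangerous m L [::] es)
     \prod_(u <- s) @phi R V L K M [::] (no_edges V) u <= 2^-1 ^+ (T + 2).
  set q : R := M%:R / 2 ^+ L * K%:R.
  have q0 : 0 <= q by rewrite !mulr_ge0 ?invr_ge0 ?exprn_ge0.
  (* Since 2 ^ L = 8 m, there are at most b ^ m sets per insertion, and the union bound reads n (b
     q) ^ m with b q <= 1/2. *)
  pose b := ((2 * K.+1 ^ 2) ^ 8)%N.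
  have b0 : (0 < b)%N by rewrite expn_gt0 muln_gt0 expn_gt0.
  have bq : b%:R * q <= 2^-1.
    have -> : b%:R * q = (b * K * M)%:R / 2 ^+ L by rewrite /q !natrM; ring.
    rewrite ler_pdivrMr ?exprn_gt0 //.
    rewrite ler_pdivlMl // e2 -!natrM ler_nat.
    by rewrite (mulnA 2 _ M) (mulnA 2 b K); exact: c1.
  have q1 : q <= 1.
    have b1 : 1 <= b%:R :> R by rewrite ler1n.
    by move: bq; nra.
  apply: le_trans (weight_start m F q1) _.
  rewrite -mL expnM -/b natrM natrX -mulrA -exprMn.
  have bq0 : 0 <= b%:R * q by apply: mulr_ge0.
  apply: le_trans nK; apply: ler_pM => //; first exact: exprn_ge0.
    by rewrite ler_nat.
  apply: le_trans (_ : 2^-1 ^+ m <= _).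
    by rewrite lerXn2r ?nnegrE ?invr_ge0.
  by rewrite eT //; move: c2; rewrite -mL leq_mul2l.
move: h1 h2 h3; rewrite e4.
set t := 2^-1 ^+ T; have : 0 <= t by rewrite exprn_ge0 // invr_ge0.
set a1 := \sum_(s <- _) _; set a2 := _ * _ ^+ M; set a3 := _ / _.
by move: a1 a2 a3 t => a1 a2 a3 t; clear; lra.
Qed.

End FiniteBound.

(** * Choice of the parameters *)

Lemma poly4_le_exp2 D K : D * 5 ^ 5 <= K -> D * K ^ 4 <= 2 ^ K.
Proof.
move=> DK; have K5 : K ^ 5 <= 5 ^ 5 * 2 ^ K.
  (* With t = K / 5 rounded down, K < 5 (t + 1) and t + 1 <= 2 ^ t. *)
  apply: leq_trans (_ : (5 * 2 ^ (K %/ 5)) ^ 5 <= _).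
    rewrite leq_exp2r // mulnC; apply: leq_trans (ltnW (ltn_ceil K (isT : 0 < 5))) _.
    by rewrite leq_mul2r ltn_expl.
  by rewrite expnMn -expnM leq_mul2l leq_exp2l // leq_trunc_div orbT.
rewrite -(leq_pmul2l (_ : 0 < 5 ^ 5)) ?expn_gt0 //; apply: leq_trans K5.
by rewrite mulnA (mulnC (5 ^ 5)) (expnS K 4) leq_mul2r DK orbT.
Qed.

(** The hypotheses of [dancing_walk_bound], with K ^ 40 for 2 ^ L, and M and L + 1 replaced by
    bounds that are linear in K. *)
Lemma parameters_eventually (A c d K : nat) :
  A + c + d + 16 * 5 ^ 5 + 3 <= K ->
  [/\ 2 * (2 * K.+1 ^ 2) ^ 8 * K * (d * K.+1 + 1) <= K ^ 40,
      8 * (K.+1 * A.+1 + 2) <= K ^ 40, 4 < K ^ 40,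
      K.+1 * A.+1 + 2 <= 3 * (A.+2 * K)
    & (c * K.+1 + 2) * (K.+1 * A + 2) <= 2 ^ K].
Proof.
set D := 16 * 5 ^ 5 => big.
have [DK AK cK dK K3] : [/\ D <= K, A.+1 <= K, c <= K, d <= K & 3 <= K].
  by move: D big => D; clear; split; lia.
have K0 : 0 < K by apply: leq_trans K3.
have KK i j : i <= j -> K ^ i <= K ^ j by move=> ij; apply: leq_pexp2l.
have sq : K.+1 * K.+1 <= 4 * (K * K) by clear -K0; nia.
have nine : 9 <= K * K by clear -K3; nia.
have c4 : c * K.+1 + 2 <= 4 * K ^ 2 by rewrite -mulnn; clear -cK K3; nia.
have A4 : K.+1 * A + 2 <= 4 * K ^ 2 by rewrite -mulnn; clear -AK K3; nia.
split.
- have e4 : 2 * K.+1 ^ 2 <= K ^ 4.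
    rewrite -mulnn (expnM K 2 2) -!mulnn; apply: leq_trans (_ : 9 * (K * K) <= _).
      by clear -sq; lia.
    by rewrite leq_mul2r nine orbT.
  have e3 : d * K.+1 + 1 <= K ^ 3.
    rewrite !expnS expn0 muln1; apply: leq_trans (_ : 3 * (K * K) <= _).
      by clear -dK K3; nia.
    by rewrite leq_mul2r K3 orbT.
  (* The exponents add up to 37; this is why c >= 40 suffices. *)
  apply: leq_trans (_ : K ^ 1 * (K ^ 4) ^ 8 * K ^ 1 * K ^ 3 <= _).
    rewrite !expn1; apply: leq_mul => //; rewrite leq_mul2r; apply/orP; right.
    by apply: leq_mul; [exact: ltnW | rewrite leq_exp2r].
  by rewrite -expnM -!expnD KK.
- apply: leq_trans (KK 6 40 isT); rewrite (expnM K 2 3).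
  have : K.+1 * A.+1 + 2 <= 4 * (K * K) by clear -AK K3; nia.
  rewrite -mulnn !expnS expn0 muln1; move: nine; move: (K * K); clear; nia.
- apply: leq_trans (KK 2 40 isT); rewrite -mulnn; apply: leq_trans nine; by [].
- by clear -AK K3; nia.
apply: leq_trans (leq_mul c4 A4) _; apply: leq_trans (poly4_le_exp2 DK).
by rewrite mulnACA -expnD.
Qed.

Local Open Scope ring_scope.

Lemma absz_ceilP (R : realType) (r : R) : 0 <= r ->
  r <= `|Num.ceil r|%N%:R < r + 1.
Proof.
move=> r0; have c0 : 0 <= Num.ceil r by rewrite ceil_ge0 (lt_le_trans _ r0) // ltrN10.
rewrite natr_absz ger0_norm // ceil_ge /=.
by have /andP[+ _] := ceil_itv r; rewrite rmorphB /= ltrBlDr.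
Qed.

(** * From real logarithms to integer parameters *)

Section Logarithms.
Variable R : realType.

Lemma log2_le (x y : R) : 0 < x -> x <= y -> log2 x <= log2 y.
Proof.
move=> x0 xy; rewrite /log2 ler_pM2r ?invr_gt0 ?ln_gt0 ?ltr1n //.
by rewrite ler_ln // posrE // (lt_le_trans x0).
Qed.

Lemma log2_exp2 i : log2 (2 ^+ i : R) = i%:R.
Proof.
rewrite /log2 lnXn // -[_ *+ i]mulr_natl mulfK //.
by rewrite gt_eqF // ln_gt0 // ltr1n.
Qed.

Lemma log2X (x : R) i : 0 < x -> log2 (x ^+ i) = i%:R * log2 x.
Proof. by move=> x0; rewrite /log2 lnXn // -[_ *+ i]mulr_natl mulrA. Qed.

Lemma log2_trunc n : (0 < n)%N ->
  (trunc_log 2 n)%:R <= log2 (n%:R : R) <= (trunc_log 2 n).+1%:R.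
Proof.
move=> n0; rewrite -[(trunc_log 2 n)%:R](@log2_exp2 _) -[(trunc_log 2 n).+1%:R](@log2_exp2 _).
apply/andP; split; apply: log2_le.
- by rewrite exprn_gt0.
- by rewrite -natrX ler_nat trunc_logP.
- by rewrite ltr0n.
by rewrite -natrX ler_nat ltnW // trunc_log_ltn.
Qed.

(** Below, 2 ^ (c log log n) is (log n) ^ c. Above, the crude estimate log log n <= K + 1 is
    enough. *)
Lemma walk_length_bounds (c : R) (c' n : nat) : 40 <= c -> c <= c'%:R ->
  (1 < trunc_log 2 n)%N ->
  (trunc_log 2 n ^ 40 <= 2 ^ walk_length c n)%N /\
  (walk_length c n < c' * (trunc_log 2 n).+1 + 1)%N.
Proof.
move=> c40 cc' K1; have n0 : (0 < n)%N by case: n K1; rewrite ?trunc_log0.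
have /andP[] := log2_trunc n0; set K := trunc_log 2 n in K1 *; set x := log2 _ => Kx xK.
have K0 : 0 < K%:R :> R by rewrite ltr0n ltnW.
have x0 : 0 < x by apply: lt_le_trans Kx.
have lK : log2 K%:R <= log2 x by apply: log2_le.
have lK0 : 0 <= log2 (K%:R : R).
  by rewrite /log2 divr_ge0 // ln_ge0 // ler1n // ltnW.
have lx : log2 x <= K.+1%:R.
  rewrite -[K.+1%:R]log2_exp2; apply: log2_le => //.
  by apply: le_trans xK _; rewrite -natrX ler_nat ltnW // ltn_expl.
have c0 : 0 <= c by apply: le_trans c40.
have lx0 : 0 <= log2 x by apply: le_trans lK.
rewrite /walk_length -/x; have /absz_ceilP := mulr_ge0 c0 lx0.
set L := `|_|%N => /andP[cL Lc]; split.
  rewrite -(ler_nat R) !natrX -ler_ln ?posrE ?exprn_gt0 //.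
  have l2 : 0 < ln (2 : R) by rewrite ln_gt0 // ltr1n.
  have : log2 (K%:R ^+ 40 : R) <= log2 (2 ^+ L : R).
    rewrite log2_exp2 log2X //; apply: le_trans cL.
    by apply: ler_pM.
  by rewrite /log2 ler_pM2r // invr_gt0.
rewrite -(ltr_nat R) natrD natrM; apply: lt_le_trans Lc _.
by rewrite lerD2r; apply: ler_pM.
Qed.

Lemma max_attempts_bounds (d : R) (d0 d' n : nat) : d0%:R <= d -> d <= d'%:R ->
  (0 < n)%N ->
  (d0 * trunc_log 2 n <= max_attempts d n)%N /\
  (max_attempts d n <= d' * (trunc_log 2 n).+1 + 1)%N.
Proof.
move=> dd dd' n0; have /andP[] := log2_trunc n0.
set K := trunc_log 2 n; rewrite /max_attempts; set x := log2 _ => Kx xK.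
have x0 : 0 <= x by apply: le_trans Kx.
have dge : 0 <= d by apply: le_trans dd.
have /absz_ceilP := mulr_ge0 dge x0; set M := `|_|%N => /andP[dM Md]; split.
  by rewrite -(ler_nat R) natrM; apply: le_trans dM; apply: ler_pM.
rewrite -(ler_nat R) natrD natrM; apply: le_trans (ltW Md) _.
by rewrite lerD2r; apply: ler_pM.
Qed.

End Logarithms.

Theorem theorem11 (R : realType) (a : R) (ha : 0 < a) :
  exists c0 d0 : R, forall c d : R, c0 <= c -> d0 <= d ->
  forall k : costs, exists (C : R) (N : nat),
  forall (n : nat) (V : finType) (es : seq (V * V)),
    (N <= n)%N -> #|V| = n -> forms_tree es ->
    1 - 1 / n%:R `^ a <=
    Pr R (fun omega : randomness n.-1 (max_attempts d n) (walk_length c n) =>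
            performs_within k es (C * n%:R) omega).
Proof.
have /absz_ceilP/andP[aA _] := ltW ha; set A := `|_|%N in aA.
(* With d >= A + 2 there are at least (A + 2) K attempts, enough for 8 ^ (- M) to beat n ^ (- A) and
   the union bound. *)
exists 40, A.+2%:R => c d c40 dA k.
have c0 : 0 <= c by apply: le_trans c40.
have d0 : 0 <= d by apply: le_trans dA.
have /absz_ceilP/andP[cc' _] := c0; set c' := `|_|%N in cc'.
have /absz_ceilP/andP[dd' _] := d0; set d' := `|_|%N in dd'.
pose kappa := (rank_cost k + try_cost k + move_cost k + flip_cost k).+1.
exists (16 * kappa)%:R, (2 ^ (A + c' + d' + 16 * 5 ^ 5 + 3))%N.
move=> n V es Nn Vn tree; subst n.
have n0 : (0 < #|V|)%N by apply: leq_trans Nn; rewrite expn_gt0.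
have KN := trunc_log_max (isT : (1 < 2)%N) Nn.
set K := trunc_log 2 #|V| in KN.
have [h1 h2 h3 h4 h5] := parameters_eventually KN.
have K1 : (1 < K)%N by apply: leq_trans KN; rewrite addnS ltnS addn2.
have [KL Lc] := walk_length_bounds c40 cc' K1.
have [dM Md] := max_attempts_bounds dA dd' n0.
rewrite -/K in KL Lc dM Md.
set L := walk_length c _ in KL Lc *; set M := max_attempts d _ in dM Md *.
(* Here n ^ a <= n ^ A <= 2 ^ ((K + 1) A). *)
apply: le_trans (_ : 1 - 2^-1 ^+ (K.+1 * A) <= _).
  rewrite lerD2l lerN2 div1r exprVn lef_pV2 ?posrE ?exprn_gt0 ?powR_gt0 ?ltr0n //.
  apply: le_trans (_ : #|V|%:R `^ A%:R <= _); first by rewrite ler_powR // ler1n.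
  rewrite powR_mulrn ?ler0n // exprM lerXn2r ?nnegrE ?ler0n ?exprn_ge0 //.
  by rewrite -natrX ler_nat ltnW // trunc_log_ltn.
apply: dancing_walk_bound => //.
- by rewrite -(ltn_exp2l 2 L (isT : 1 < 2)%N); apply: leq_trans KL.
- by apply: leq_trans KL; apply: leq_trans h1; rewrite leq_mul2l Md orbT.
- exact: leq_trans h2 KL.
- by apply: leq_trans h4 _; rewrite leq_mul2l dM.
apply: leq_trans (trunc_logP (isT : (1 < 2)%N) n0); apply: leq_trans h5.
by rewrite leq_mul2r; apply/orP; right; move: Lc; rewrite addn1 addn2 !ltnS => /leqW.
Qed.
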